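(* Let $\Omega=\bigcup_{i=1}^n(\alpha_i,\beta_i)$ with $-\infty<\alpha_1<\beta_1<\alpha_2<\beta_2<\dots<\alpha_n<\beta_n<\infty$. For $\lambda\in\mathbb{C}$ let $D_\alpha(\lambda)$ and $D_\beta(\lambda)$ be the diagonal $n\times n$ matrices with diagonal entries $e^{2\pi \mathrm{i}\lambda\alpha_i}$, $i=1,\dots,n$, and $e^{2\pi \mathrm{i}\lambda\beta_i}$, $i=1,\dots,n$, respectively. The set $\Omega$ is spectral if and only if there exists a spectral unitary matrix $B$ for $\Omega$. Moreover, any spectrum for $\Omega$ is given by $$\Lambda_B:=\{\lambda\in\mathbb{C}:\det(I-D_\beta(-\lambda)BD_\alpha(\lambda))=0\}=\{\lambda\in\mathbb{R}: Be_\lambda(\alpha)=e_\lambda(\beta)\}$$ for a unique spectral unitary matrix $B$ for $\Omega$.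
   Context: $e_\lambda(x)=e^{2\pi \mathrm{i}\lambda x}$; $e_\lambda(\alpha)=(e_\lambda(\alpha_1),\dots,e_\lambda(\alpha_n))^t$ and $e_\lambda(\beta)=(e_\lambda(\beta_1),\dots,e_\lambda(\beta_n))^t$. $\Omega$ is spectral with spectrum $\Lambda\subset\mathbb{R}$ if $\{|\Omega|^{-1/2}e_\lambda:\lambda\in\Lambda\}$ is an orthonormal basis of $L^2(\Omega)$. With $\mathbf{1}=(1,\dots,1)\in\mathbb{C}^n$, an $n\times n$ unitary matrix $B$ is called spectral for $\Omega$ if for every $\lambda\in\mathbb{C}$, $\ker(I-D_\beta(-\lambda)BD_\alpha(\lambda))$ is either $\{0\}$ or $\mathbb{C}\mathbf{1}$. *)

(* Defs.v *)
From HB Require Import structures.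
From mathcomp Require Import all_boot all_order all_algebra.
From mathcomp Require Import complex.
From mathcomp Require Import all_classical all_reals all_analysis.

Set Implicit Arguments.
Unset Strict Implicit.
Unset Printing Implicit Defensive.

Import Order.TTheory GRing.Theory Num.Theory.

Local Open Scope classical_set_scope.
Local Open Scope ring_scope.
Local Open Scope complex_scope.

Section Exponentials.
Context {R : realType}.

Definition cexp (z : R[i]) : R[i] :=
  (expR (complex.Re z))%:C
    * (cos (complex.Im z) +i* sin (complex.Im z)).

Definition expo (lambda : R[i]) (x : R) : R[i] :=
  cexp ('i * (2 * pi)%:C * lambda * x%:C).

End Exponentials.

(* Elements of L^2(D) are represented by functions R -> R[i]; only their
   values on D matter, up to Lebesgue-null sets. *)
Section ComplexL2.
Context {R : realType}.

Definition cintegral (D : set R) (f : R -> R[i]) : R[i] :=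
  (\int[lebesgue_measure]_(x in D) complex.Re (f x))
    +i* (\int[lebesgue_measure]_(x in D) complex.Im (f x)).

Definition in_L2 (D : set R) (f : R -> R[i]) : Prop :=
  [/\ measurable_fun D (fun x => complex.Re (f x)),
      measurable_fun D (fun x => complex.Im (f x)) &
      (\int[lebesgue_measure]_(x in D) (Normc.normc (f x) ^+ 2)%:E < +oo)%E].

Definition L2_inner (D : set R) (f g : R -> R[i]) : R[i] :=
  cintegral D (fun x => f x * (g x)^*).

Definition L2_norm (D : set R) (f : R -> R[i]) : R :=
  Num.sqrt (\int[lebesgue_measure]_(x in D) (Normc.normc (f x) ^+ 2)).

(* "Basis" in the Hilbert-space sense: finite linear combinations are
   dense in L^2(D). *)
Definition L2_orthonormal_basis (I : eqType) (D : set R) (S : set I)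
    (phi : I -> R -> R[i]) : Prop :=
  [/\ forall i, S i -> in_L2 D (phi i),
      forall i j, S i -> S j -> L2_inner D (phi i) (phi j) = (i == j)%:R &
      forall f, in_L2 D f -> forall eps : R, 0 < eps ->
        exists (s : seq I) (c : I -> R[i]),
          (forall i, i \in s -> S i) /\
          L2_norm D (fun x => f x - \sum_(i <- s) c i * phi i x) < eps].

Definition is_spectrum (Omega Lambda : set R) : Prop :=
  L2_orthonormal_basis Omega Lambda (fun lambda x =>
    ((Num.sqrt (fine (lebesgue_measure Omega)))^-1)%:C * expo lambda%:C x).

Definition spectral_set (Omega : set R) : Prop :=
  exists Lambda : set R, is_spectrum Omega Lambda.

End ComplexL2.

Section SpectralMatrices.
Context {R : realType} {n : nat}.
Implicit Types (a alpha beta : 'I_n -> R) (B : 'M[R[i]]_n) (lambda : R[i]).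

Definition interval_union alpha beta : set R :=
  \bigcup_(i in [set: 'I_n]) `]alpha i, beta i[%classic.

Definition expo_vec lambda a : 'cV[R[i]]_n := \col_i expo lambda (a i).

Definition expo_diag a lambda : 'M[R[i]]_n :=
  diag_mx (\row_i expo lambda (a i)).

Definition char_mx alpha beta B lambda : 'M[R[i]]_n :=
  1%:M - expo_diag beta (- lambda) *m B *m expo_diag alpha lambda.

(* Kernel for the action on column vectors; [kermx] is the row kernel. *)
Definition col_ker (A : 'M[R[i]]_n) : set 'cV[R[i]]_n :=
  [set v | A *m v = 0].

Definition spectral_unitary alpha beta B : Prop :=
  B \is unitarymx /\
  forall lambda,
    col_ker (char_mx alpha beta B lambda) = [set 0] \/
    col_ker (char_mx alpha beta B lambda) =
      [set c *: (const_mx 1 : 'cV[R[i]]_n) | c in [set: R[i]]].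

Definition Lambda_of alpha beta B : set R[i] :=
  [set lambda | \det (char_mx alpha beta B lambda) = 0].

End SpectralMatrices.

(* Main.v *)
(** The operator [D = 1 / (2 pi i) d/dx] with boundary condition
    [B f(alpha) = f(beta)], [B] unitary, is self-adjoint on [L^2(Omega)]; its
    eigenfunctions for the eigenvalue [z] are the functions equal to
    [v_j e_z] on the [j]-th interval, with [v] in the kernel of the
    characteristic matrix, and they are multiples of [e_z] exactly when [B] is
    spectral.

    From a spectrum [Lambda] to [B]: integrating by parts, the orthogonality
    of the [e_t] says that [e_s(alpha) |-> e_s(beta)] preserves scalar products.
    For a nonreal [z], completeness shows that the vectors
    [D_beta(z)^* e_t(beta) - D_alpha(z)^* e_t(alpha)] span [C^n]; as the [e_t(beta)]
    depend isometrically on the [e_t(alpha)], the latter span [C^n] too, which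
    gives existence and uniqueness of [B].

    From [B] to a spectrum: the eigenvalues are separated, so those within
    distance [N] of a non-eigenvalue [l0] form a finite set [F].  On the
    orthogonal complement of the [e_t] with [t] in [F], [D - l] is bounded
    below for every real [l] with [|l - l0| < N], by variation of constants.
    For a symmetric operator with inverse [T] this forces [|T| <= 1 / N],
    without any compactness argument; hence [N |h| <= |(D - l0) f|] for the
    projection [h] of [f] on that complement, and the span of the
    eigenfunctions is dense. *)

Require Import Defs.
From HB Require Import structures.
From mathcomp Require Import all_boot all_order all_algebra.
From mathcomp Require Import complex.
From mathcomp Require Import all_classical all_reals all_analysis.
From mathcomp Require Import measurable_realfun ring lra.

Set Implicit Arguments.
Unset Strict Implicit.
Unset Printing Implicit Defensive.

Import Order.TTheory GRing.Theory Num.Theory.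
Import numFieldNormedType.Exports.

Local Open Scope classical_set_scope.
Local Open Scope ring_scope.
Local Open Scope complex_scope.

(** * Calculus of complex-valued functions of a real variable *)

Section ComplexCalculus.
(* On top of the scope stack, [ring_scope] makes [z^*] denote [Num.conj z], as
   it does inside the products of the definition of [L2_inner]. *)
Local Open Scope ring_scope.
Context {R : realType}.
Local Notation C := R[i].
Local Notation Re := (@complex.Re R).
Local Notation Im := (@complex.Im R).
Implicit Types (f g F G : R -> C) (z : C).

Lemma complex_eqP z (w : C) : Re z = Re w -> Im z = Im w -> z = w.
Proof. by case: z w => [a b] [c d] /= -> ->. Qed.

Lemma ReM z w : Re (z * w) = Re z * Re w - Im z * Im w.
Proof. by case: z w => [a b] [c d]. Qed.

Lemma ImM z w : Im (z * w) = Re z * Im w + Im z * Re w.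
Proof. by case: z w => [a b] [c d]. Qed.

Lemma ReD z w : Re (z + w) = Re z + Re w.
Proof. by case: z w => [a b] [c d]. Qed.

Lemma ImD z w : Im (z + w) = Im z + Im w.
Proof. by case: z w => [a b] [c d]. Qed.

Lemma ReB z w : Re (z - w) = Re z - Re w.
Proof. by case: z w => [a b] [c d]. Qed.

Lemma ImB z w : Im (z - w) = Im z - Im w.
Proof. by case: z w => [a b] [c d]. Qed.

Lemma ReJ z : Re (z^*) = Re z. Proof. by case: z. Qed.
Lemma ImJ z : Im (z^*) = - Im z. Proof. by case: z. Qed.

Lemma conjCr (t : R) : (t%:C)^* = t%:C.
Proof. exact: conjc_real. Qed.

Lemma complex_Re_Im z : Im z = 0 -> z = (Re z)%:C.
Proof. by case: z => a b /= ->. Qed.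

Lemma mulcJ z : z * z^* = ((Re z) ^+ 2 + (Im z) ^+ 2)%:C.
Proof.
by apply: complex_eqP; rewrite ?ReM ?ImM ReJ ImJ /=; ring.
Qed.

Lemma normc_sqr z : Normc.normc z ^+ 2 = (Re z) ^+ 2 + (Im z) ^+ 2.
Proof. by case: z => a b /=; rewrite sqr_sqrtr// addr_ge0// sqr_ge0. Qed.

(** Continuity and derivatives are taken componentwise and on the whole line: a function on an
    interval is represented by an extension, so no one-sided derivative occurs at an endpoint. *)
Definition ccont f :=
  continuous (fun x => Re (f x)) /\ continuous (fun x => Im (f x)).

Definition cder F f := forall x : R,
  is_derive x 1 (fun y => Re (F y)) (Re (f x)) /\
  is_derive x 1 (fun y => Im (F y)) (Im (f x)).

Lemma ccont_cst z : ccont (fun=> z).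
Proof. by split=> x; exact: cvg_cst. Qed.

Lemma ccontD f g : ccont f -> ccont g -> ccont (fun x => f x + g x).
Proof.
move=> [fr fi] [gr gi]; split=> x.
  under eq_fun do rewrite ReD.
  by apply: cvgD; [exact: fr|exact: gr].
under eq_fun do rewrite ImD.
by apply: cvgD; [exact: fi|exact: gi].
Qed.

Lemma ccontM f g : ccont f -> ccont g -> ccont (fun x => f x * g x).
Proof.
move=> [fr fi] [gr gi]; split=> x.
  under eq_fun do rewrite ReM.
  by apply: cvgB; apply: cvgM; [exact: fr|exact: gr|exact: fi|exact: gi].
under eq_fun do rewrite ImM.
by apply: cvgD; apply: cvgM; [exact: fr|exact: gi|exact: fi|exact: gr].
Qed.

Lemma ccontJ f : ccont f -> ccont (fun x => (f x)^*).
Proof.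
move=> [fr fi]; split=> x.
  by under eq_fun do rewrite ReJ; exact: fr.
by under eq_fun do rewrite ImJ; apply: cvgN; exact: fi.
Qed.

Lemma cder_ext F f g : cder F f -> f =1 g -> cder F g.
Proof. by move=> Ff fg x; rewrite -fg. Qed.

Lemma cder_cont F f : cder F f -> ccont F.
Proof.
move=> Ff; split=> x; have [[d _] [e _]] := Ff x;
  apply/differentiable_continuous/derivable1_diffP; [exact: d|exact: e].
Qed.

Lemma cder_cst z : cder (fun=> z) (fun=> 0).
Proof. by move=> x; split; exact: is_derive_cst. Qed.

Lemma cderD F G f g : cder F f -> cder G g ->
  cder (fun x => F x + G x) (fun x => f x + g x).
Proof.
move=> Ff Gg x; have [fr fi] := Ff x; have [gr gi] := Gg x; split.
  by under eq_fun do rewrite ReD; rewrite ReD; exact: is_deriveD.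
by under eq_fun do rewrite ImD; rewrite ImD; exact: is_deriveD.
Qed.

Lemma cderJ F f : cder F f -> cder (fun x => (F x)^*) (fun x => (f x)^*).
Proof.
move=> Ff x; have [fr fi] := Ff x; split.
  by under eq_fun do rewrite ReJ; rewrite ReJ.
by under eq_fun do rewrite ImJ; rewrite ImJ; exact: is_deriveN.
Qed.

Lemma cderM F G f g : cder F f -> cder G g ->
  cder (fun x => F x * G x) (fun x => f x * G x + F x * g x).
Proof.
move=> Ff Gg x; have [fr fi] := Ff x; have [gr gi] := Gg x; split.
  under eq_fun do rewrite ReM; rewrite ReD !ReM.
  have -> : Re (f x) * Re (G x) - Im (f x) * Im (G x) +
     (Re (F x) * Re (g x) - Im (F x) * Im (g x)) =
    (Re (F x) *: Re (g x) + Re (G x) *: Re (f x)) -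
    (Im (F x) *: Im (g x) + Im (G x) *: Im (f x)).
    by rewrite /GRing.scale /=; ring.
  by apply: is_deriveB; exact: is_deriveM.
under eq_fun do rewrite ImM; rewrite ImD !ImM.
have -> : Re (f x) * Im (G x) + Im (f x) * Re (G x) +
     (Re (F x) * Im (g x) + Im (F x) * Re (g x)) =
    (Re (F x) *: Im (g x) + Im (G x) *: Re (f x)) +
    (Im (F x) *: Re (g x) + Re (G x) *: Im (f x)).
  by rewrite /GRing.scale /=; ring.
by apply: is_deriveD; exact: is_deriveM.
Qed.

Lemma cderZ z F f : cder F f -> cder (fun x => z * F x) (fun x => z * f x).
Proof.
move=> Ff; apply: (cder_ext (cderM (cder_cst z) Ff)) => x.
by rewrite mul0r add0r.
Qed.

Lemma cexp0 : cexp (0 : C) = 1.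
Proof. by rewrite /cexp /= expR0 cos0 sin0 mul1r. Qed.

Lemma cexpD z w : cexp (z + w) = cexp z * cexp w.
Proof.
by apply: complex_eqP; rewrite /cexp !(ReM, ImM, ReD, ImD) /= expRD cosD sinD; ring.
Qed.

Lemma cexpJ z : (cexp z)^* = cexp (z^*).
Proof.
apply: complex_eqP; rewrite /cexp ?ReJ ?ImJ ?ReM ?ImM /= ?ReJ ?ImJ ?cosN ?sinN; ring.
Qed.

Lemma cder_cexp z : cder (fun x => cexp (z * x%:C)) (fun x => z * cexp (z * x%:C)).
Proof.
move=> x.
have E y : Re (z * y%:C) = Re z * y /\ Im (z * y%:C) = Im z * y.
  by rewrite ReM ImM /=; split; ring.
have dE : is_derive x 1 (fun y => expR (Re z * y)) (Re z * expR (Re z * x)).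
  apply: is_derive_eq; rewrite /GRing.scale /=; ring.
have dc : is_derive x 1 (fun y => cos (Im z * y)) (- (Im z * sin (Im z * x))).
  apply: is_derive_eq; rewrite /GRing.scale /=; ring.
have ds : is_derive x 1 (fun y => sin (Im z * y)) (Im z * cos (Im z * x)).
  apply: is_derive_eq; rewrite /GRing.scale /=; ring.
have Er y : Re (cexp (z * y%:C)) = expR (Re z * y) * cos (Im z * y).
  by rewrite /cexp ReM !(E y).1 (E y).2 /=; ring.
have Ei y : Im (cexp (z * y%:C)) = expR (Re z * y) * sin (Im z * y).
  by rewrite /cexp ImM !(E y).1 (E y).2 /=; ring.
split.
  under eq_fun do rewrite Er; rewrite ReM Er Ei.
  apply: is_derive_eq; rewrite /GRing.scale /=; ring.
under eq_fun do rewrite Ei; rewrite ImM Er Ei.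
apply: is_derive_eq; rewrite /GRing.scale /=; ring.
Qed.

Definition tpi : C := 0 +i* (2 * pi).

Lemma tpi_neq0 : tpi != 0.
Proof.
by rewrite eq_complex /= eqxx mulf_neq0 ?pnatr_eq0// gt_eqF// pi_gt0.
Qed.

Lemma expoE z (x : R) : expo z x = cexp (tpi * z * x%:C).
Proof.
rewrite /expo (_ : 'i%C * (2 * pi)%:C = tpi)//.
by apply: complex_eqP; rewrite ?ReM ?ImM /=; ring.
Qed.

Lemma expo0 (x : R) : expo 0 x = 1.
Proof. by rewrite expoE mulr0 mul0r cexp0. Qed.

Lemma expoD z w (x : R) : expo (z + w) x = expo z x * expo w x.
Proof. by rewrite !expoE mulrDr mulrDl cexpD. Qed.

Lemma expoK z (x : R) : expo (- z) x * expo z x = 1.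
Proof. by rewrite -expoD addNr expo0. Qed.

Lemma tpiJ : tpi^* = - tpi.
Proof. by apply: complex_eqP; rewrite /tpi /=; ring. Qed.

Lemma expoJ z (x : R) : (expo z x)^* = expo (- z^*) x.
Proof.
by rewrite !expoE cexpJ !rmorphM /= tpiJ conjCr mulrN mulNr.
Qed.

Lemma expoJr (t x : R) : (expo t%:C x)^* = expo (- t%:C) x.
Proof. by rewrite expoJ conjCr. Qed.

Lemma cder_expo z : cder (expo z) (fun x => tpi * z * expo z x).
Proof.
have -> : expo z = (fun x => cexp (tpi * z * x%:C)).
  by apply/funext => x; exact: expoE.
exact: cder_cexp.
Qed.

Lemma ccont_expo z : ccont (expo z).
Proof. exact: cder_cont (cder_expo z). Qed.

(** For nonreal [z] this is strictly monotone in [x], which will exclude nonreal eigenvalues. *)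
Lemma expo_mulJ z (x : R) :
  expo z x * (expo z x)^* = (expR (- (4 * pi * Im z * x)))%:C.
Proof.
rewrite expoJ -expoD expoE /cexp.
have -> : tpi * (z - z^*) * x%:C = (- (4 * pi * Im z * x))%:C.
  by apply: complex_eqP; rewrite /tpi !(ReM, ImM, ReD, ImD) /= ?ReJ ?ImJ; case: z => a b /=; ring.
by rewrite /= cos0 sin0 mulr1.
Qed.

End ComplexCalculus.

(** * Integrals of continuous complex functions over bounded intervals *)

Section Integral.
Local Open Scope ring_scope.
Context {R : realType}.
Local Notation C := R[i].
Local Notation Re := (@complex.Re R).
Local Notation Im := (@complex.Im R).
Local Notation mu := (@lebesgue_measure R).

Section RealCase.
Implicit Types f F : R -> R.

Lemma continuous_itv_integrable f (a b : R) : continuous f ->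
  mu.-integrable `[a, b] (EFin \o f).
Proof.
move=> cf; apply: continuous_compact_integrable; first exact: segment_compact.
exact: continuous_subspaceT.
Qed.

Lemma Rintegral_itv_split f (a x b : R) : continuous f -> a <= x -> x <= b ->
  \int[mu]_(t in `[a, b]) f t = \int[mu]_(t in `[a, x]) f t + \int[mu]_(t in `[x, b]) f t.
Proof.
move=> cf ax xb; apply/eqP; rewrite addrC -subr_eq; apply/eqP.
have := @Rintegral_itvB R f (BLeft a) (BRight b) x.
move=> ->//; [|exact: continuous_itv_integrable].
apply: Rintegral_itv_obnd_cbnd.
by apply: integrableS (continuous_itv_integrable x b cf) => //; exact: subset_itv_oc_cc.
Qed.

Lemma continuous_primitive f : continuous f ->
  exists F, forall x : R, is_derive x 1 F (f x).
Proof.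
move=> cf.
(* At most one of the two domains has positive measure, so [F] is the oriented integral from 0. *)
pose F (x : R) := \int[mu]_(t in `[0, x]) f t - \int[mu]_(t in `[x, 0]) f t.
exists F => x.
(* To the right of a base point [a] lying left of both 0 and [x], [F] differs by a constant from the
   integral from [a], to which the fundamental theorem of calculus applies. *)
pose a : R := Num.min 0 x - 1.
have a0 : a < 0 by rewrite /a ltrBlDr add0r gt_min ltr01.
have ax : a < x by rewrite /a ltrBlDr gt_min ltrDl ltr01 orbT.
pose G (y : R) := \int[mu]_(t in `[a, y]) f t.
have FG y : a < y -> F y = G y - G 0.
  move=> ay; rewrite /F /G; have [y0|y0] := leP y 0.
    rewrite (Rintegral_itv_split cf (ltW ay) y0).
    suff -> : \int[mu]_(t in `[0, y]) f t = 0 by ring.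
    move: y0; rewrite le_eqVlt => /predU1P[->|y0].
      by rewrite set_itv1 Rintegral_set1.
    by rewrite set_itv_ge ?Rintegral_set0// bnd_simp -ltNge.
  rewrite (Rintegral_itv_split cf (ltW a0) (ltW y0)).
  suff -> : \int[mu]_(t in `[y, 0]) f t = 0 by ring.
  by rewrite set_itv_ge ?Rintegral_set0// bnd_simp -ltNge.
have x1 : x < x + 1 by rewrite ltrDl.
have [dG eG] := continuous_FTC1 x1 (continuous_itv_integrable a (x + 1) cf) ax (cf x).
have dG' : is_derive x 1 G (f x) by apply: DeriveDef; [exact: dG|rewrite -derive1E; exact: eG].
clearbody F G.
apply: (@near_eq_is_derive _ _ _ (fun y => G y - G 0)).
  by near=> y; rewrite FG//; near: y; exact: lt_nbhsr.
rewrite -[f x]subr0; exact: is_deriveB.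
Unshelve. all: by end_near. Qed.

Lemma Rintegral_oo_FTC f F (a b : R) : continuous f -> a <= b ->
  (forall x : R, is_derive x 1 F (f x)) ->
  \int[mu]_(x in `]a, b[) f x = F b - F a.
Proof.
move=> cf; rewrite le_eqVlt => /predU1P[->|ab] dF.
  by rewrite set_itv_ge ?bnd_simp ?ltxx// Rintegral_set0 subrr.
have cF : continuous F.
  by move=> x; have [d _] := dF x; apply/differentiable_continuous/derivable1_diffP.
have ioo : mu.-integrable `]a, b[ (EFin \o f).
  by apply: integrableS (continuous_itv_integrable a b cf) => //; exact: subset_itv_oo_cc.
have ico : mu.-integrable `[a, b[ (EFin \o f).
  by apply: integrableS (continuous_itv_integrable a b cf) => //; exact: subset_itv_co_cc.
rewrite Rintegral_itv_obnd_cbnd// Rintegral_itv_bndo_bndc//.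
rewrite /Rintegral (@continuous_FTC2 R f F)//.
- exact: continuous_subspaceT.
- split; [by move=> x _; have [] := dF x| |].
  + exact/cvg_at_right_filter/cF.
  + exact/cvg_at_left_filter/cF.
- by move=> x _; rewrite derive1E; have [_ ->] := dF x.
Qed.

End RealCase.

Implicit Types (f g F G : R -> C) (z : C).

Local Notation cint a b f := (cintegral `]a, b[%classic f).

Lemma ccont_primitive f : ccont f -> exists F, cder F f.
Proof.
move=> [/continuous_primitive[F dF] /continuous_primitive[G dG]].
by exists (fun x => F x +i* G x) => x; split; [exact: dF|exact: dG].
Qed.

Lemma cint_FTC F f (a b : R) : ccont f -> a <= b -> cder F f ->
  cint a b f = F b - F a.
Proof.
move=> [cr ci] ab dF; rewrite /cintegral.
rewrite (Rintegral_oo_FTC cr ab (fun x => (dF x).1)).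
rewrite (Rintegral_oo_FTC ci ab (fun x => (dF x).2)).
by apply: complex_eqP; case: (F b) => ? ?; case: (F a) => ? ?.
Qed.

Lemma eq_cint (a b : R) f g : {in `]a, b[, f =1 g} -> cint a b f = cint a b g.
Proof.
move=> fg; rewrite /cintegral; congr (_ +i* _); apply: eq_Rintegral => x;
  by rewrite inE /= => xab; rewrite fg.
Qed.

(** Linearity and conjugation are inherited from the rules of differentiation, through
    primitives. *)
Lemma cintD (a b : R) f g : a <= b -> ccont f -> ccont g ->
  cint a b (fun x => f x + g x) = cint a b f + cint a b g.
Proof.
move=> ab cf cg; have [F dF] := ccont_primitive cf.
have [G dG] := ccont_primitive cg.
rewrite (cint_FTC cf ab dF) (cint_FTC cg ab dG).
by rewrite (cint_FTC (ccontD cf cg) ab (cderD dF dG)); ring.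
Qed.

Lemma cintZ (a b : R) z f : a <= b -> ccont f ->
  cint a b (fun x => z * f x) = z * cint a b f.
Proof.
move=> ab cf; have [F dF] := ccont_primitive cf.
rewrite (cint_FTC cf ab dF).
by rewrite (cint_FTC (ccontM (ccont_cst z) cf) ab (cderZ z dF)); ring.
Qed.

Lemma cintJ (a b : R) f : a <= b -> ccont f ->
  cint a b (fun x => (f x)^*) = (cint a b f)^*.
Proof.
move=> ab cf; have [F dF] := ccont_primitive cf.
rewrite (cint_FTC cf ab dF) (cint_FTC (ccontJ cf) ab (cderJ dF)).
by rewrite rmorphB.
Qed.

Lemma cint_cst (a b : R) z : a <= b -> cint a b (fun=> z) = z * (b - a)%:C.
Proof.
move=> ab; rewrite (@cint_FTC (fun x => z * x%:C))//; [|exact: ccont_cst|].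
  by rewrite rmorphB; ring.
have d1 : cder (real_complex R) (fun=> 1).
  by move=> x; split; [exact: is_derive_id|exact: is_derive_cst].
by apply: (cder_ext (cderZ z d1)) => x; rewrite mulr1.
Qed.

Lemma cint_ge0 (a b : R) f : {in `]a, b[, forall x, 0 <= f x} ->
  0 <= cint a b f.
Proof.
move=> f0; rewrite (@eq_cint a b f (fun x => (Re (f x))%:C)); last first.
  move=> x xab; apply: complex_Re_Im.
  by have := f0 x xab; rewrite lecE => /andP[/eqP].
rewrite lecE /=; apply/andP; split; first by rewrite /Rintegral integral0.
by apply: Rintegral_ge0 => x /f0; rewrite lecE => /andP[].
Qed.

Lemma cint_sqr_ge0 (a b : R) f : 0 <= cint a b (fun x => f x * (f x)^*).
Proof. by apply: cint_ge0 => x _; exact: mulcJ_ge0. Qed.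

Lemma ccont_sqr f : ccont f -> ccont (fun x => f x * (f x)^*).
Proof. by move=> cf; apply: ccontM => //; exact: ccontJ. Qed.

(* The square integral of [f] minus its mean is nonnegative. *)
Lemma cint_cauchy_schwarz (a b : R) f : a <= b -> ccont f ->
  cint a b f * (cint a b f)^* <= (b - a)%:C * cint a b (fun x => f x * (f x)^*).
Proof.
move=> + cf; rewrite le_eqVlt => /predU1P[->|ab].
  rewrite subrr mul0r /cintegral set_itv_ge ?bnd_simp ?ltxx//.
  by rewrite !Rintegral_set0 mul0r.
have ab' := ltW ab.
set L := (b - a)%:C; set J := cint a b f; set q := cint a b _.
have L0 : 0 < L by rewrite ltcR subr_gt0.
have := cint_sqr_ge0 a b (fun x => L * f x + - J).
have -> : cint a b (fun x => (L * f x + - J) * (L * f x + - J)^*) =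
  L * (L * q - J * J^*).
  have -> : (fun x => (L * f x + - J) * (L * f x + - J)^*) =
    (fun x => (L * L) * (f x * (f x)^*) + (- (L * J^*) * f x +
       (- (L * J) * (f x)^* + J * J^*))).
    apply/funext => x; rewrite rmorphD rmorphN rmorphM /= conjCr -/L; ring.
  rewrite cintD//; last 2 first.
    by apply: ccontM; [exact: ccont_cst|exact: ccont_sqr].
    apply: ccontD; first by apply: ccontM => //; exact: ccont_cst.
    by apply: ccontD; [apply: ccontM;[exact: ccont_cst|exact: ccontJ]|exact: ccont_cst].
  rewrite cintZ//; last exact: ccont_sqr.
  rewrite cintD//; last 2 first.
    by apply: ccontM => //; exact: ccont_cst.
    by apply: ccontD; [apply: ccontM;[exact: ccont_cst|exact: ccontJ]|exact: ccont_cst].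
  rewrite cintZ// cintD//; last 2 first.
    by apply: ccontM;[exact: ccont_cst|exact: ccontJ].
    exact: ccont_cst.
  rewrite (cintZ (- (L * J)) ab' (ccontJ cf)).
  by rewrite cintJ// cint_cst// -/L -/J -/q; ring.
by rewrite pmulr_rge0// subr_ge0.
Qed.

End Integral.

(** * A spectral gap estimate *)

Section SpectralGap.
Local Open Scope ring_scope.
Context {R : realType} {U : lmodType R[i]}.
Local Notation C := R[i].
Local Notation Re := (@complex.Re R).
(** [D] is the subspace on which [ip] is a positive semidefinite Hermitian form. In the application
    [U] contains all tuples of functions and [D] the continuous ones. *)
Variables (D : U -> Prop) (ip : U -> U -> C).
Hypothesis DL : forall z u v, D u -> D v -> D (z *: u + v).
Hypothesis ipL : forall z u v w, D u -> D v -> D w ->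
  ip (z *: u + v) w = z * ip u w + ip v w.
Hypothesis ipJ : forall u v, D u -> D v -> ip v u = (ip u v)^*.
Hypothesis ip_ge0 : forall u, D u -> 0 <= ip u u.

Let q u := Re (ip u u).

Lemma form_ge0 u : D u -> 0 <= q u.
Proof. by move=> /ip_ge0; rewrite lecE => /andP[]. Qed.

Lemma formZD (t : R) u v : D u -> D v ->
  q (t%:C *: u + v) = t ^+ 2 * q u + 2 * t * Re (ip u v) + q v.
Proof.
move=> Du Dv; have Dw := DL t%:C Du Dv.
rewrite /q ipL// (ipJ Dw Du) (ipJ Dw Dv) !ipL// !rmorphD !rmorphM /= !conjCr.
rewrite -(ipJ Du Du) -(ipJ Dv Dv) -(ipJ Dv Du).
by rewrite !(ReM, ReD) ReJ /=; ring.
Qed.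

(** The squared norms of [t u + v] and [- t u + v] add up to the right-hand side, and the second is
    nonnegative. *)
Lemma form_parallelogram (t : R) u v : t ^+ 2 = 1 -> D u -> D v ->
  q (t%:C *: u + v) <= 2 * q u + 2 * q v.
Proof.
move=> t1 Du Dv; have := form_ge0 (DL (- t)%:C Du Dv).
by rewrite !formZD// sqrrN !t1; lra.
Qed.

Lemma formZ (t : R) u : D u -> q (t%:C *: u) = t ^+ 2 * q u.
Proof.
move=> Du.
have D0 : D 0 by rewrite -(subrr u) addrC -scaleN1r; exact: DL.
have e : ip 0 u = 0.
  by have := @ipL (-1) 0 0 u D0 D0 Du; rewrite scaler0 addr0 mulN1r addNr.
have := formZD t Du D0; rewrite addr0.
have e0 : ip u 0 = 0 by rewrite (ipJ D0 Du) e rmorph0.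
have e00 : ip 0 0 = 0.
  by have := @ipL (-1) 0 0 0 D0 D0 D0; rewrite scaler0 addr0 mulN1r addNr.
by rewrite /q e0 e00 /= !mulr0 !addr0.
Qed.

(** [G] is the graph of an operator [A]: [G h w] reads [A h = w]. By [G_inv] the inverse can be
    applied once more to any [h] in the domain. The constant in [G_bound] may depend on [l] in any
    way. *)
Variables (G : U -> U -> Prop) (N : R).
Hypothesis GD : forall h w, G h w -> D h /\ D w.
Hypothesis GL : forall z h w h' w', G h w -> G h' w' ->
  G (z *: h + h') (z *: w + w').
Hypothesis G_sym : forall h w h' w', G h w -> G h' w' -> ip w h' = ip h w'.
Hypothesis G_inv : forall h w, G h w -> exists k, G k h.
Hypothesis N_gt0 : 0 < N.
Hypothesis G_bound : forall l : R, `|l| < N -> exists2 c : R, 0 <= c &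
  forall h w, G h w -> q h <= c * q ((- l)%:C *: h + w).

(* With [T] the inverse of the operator of graph [G] and [s] the squared norm
   of [T], the norm identity
   [|T^2 w - s w|^2 = |T^2 w|^2 - 2 s |T w|^2 + s^2 |w|^2 <= s (s |w|^2 - |T w|^2)]
   contradicts the minimality of [s] as soon as [T - sqrt s] and [T + sqrt s]
   are both bounded below. *)
Lemma spectral_gap h w : G h w -> N ^+ 2 * q h <= q w.
Proof.
pose S : set R := [set K | 0 <= K /\ forall h w, G h w -> q h <= K * q w].
have S_neq0 : S !=set0.
  have n0 : `|0 : R| < N by rewrite normr0.
  have [c c0 cP] := G_bound n0.
  exists c; split=> // h' w' Ghw; have := cP _ _ Ghw.
  by rewrite oppr0 scale0r add0r.
have S_lb : lbound S 0 by move=> x [].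
pose s := inf S.
have s0 : 0 <= s by exact: lb_le_inf.
(* The infimum is itself an admissible constant; when [q w'] is 0 and cannot be divided by, any
   member of [S] gives the bound. *)
have sS h' w' : G h' w' -> q h' <= s * q w'.
  move=> Ghw; have [Dh Dw] := GD Ghw.
  have := form_ge0 Dw; rewrite le_eqVlt => /predU1P[w0|w0].
    have [K [_ /(_ _ _ Ghw)]] := S_neq0.
    by rewrite -w0 !mulr0.
  rewrite -ler_pdivrMr//; apply: lb_le_inf => // K [_ /(_ _ _ Ghw)].
  by rewrite ler_pdivrMr.
have N0 : N != 0 by rewrite gt_eqF.
have [sN|Ns] := leP s (N ^- 2).
  move=> Ghw; have [Dh Dw] := GD Ghw.
  rewrite -ler_pdivlMl ?exprn_gt0//; apply: (le_trans (sS _ _ Ghw)).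
  by apply: ler_wpM2r => //; exact: form_ge0.
exfalso; have {}s0 : 0 < s by apply: lt_trans Ns; rewrite invr_gt0 exprn_gt0.
pose r := Num.sqrt s.
have r0 : 0 < r by rewrite sqrtr_gt0.
have rr : r ^+ 2 = s by rewrite sqr_sqrtr// ltW.
(* As [s] exceeds [N ^- 2], both [r^-1] and [- r^-1] are in the range of [G_bound]. *)
have kN : r^-1 < N.
  rewrite -(@ltr_pXn2r _ 2) ?nnegrE ?invr_ge0 ?(ltW r0) ?(ltW N_gt0)//.
  by rewrite exprVn rr invf_plt ?posrE ?exprn_gt0//; rewrite -exprVn.
have nk : `|r^-1| < N by rewrite gtr0_norm ?invr_gt0.
have nNk : `|- r^-1| < N by rewrite normrN.
have [c1 c10 c1P] := G_bound nk.
have [c2 c20 c2P] := G_bound nNk.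
(* This constant composes [Hc], [Hb], [Ha] and [d_le] into [q h <= c * (s * q w - q h)]; solving for
   [q h] gives the admissible constant [c * s / (1 + c)], smaller than [s]. *)
pose c := c2 * s^-1 * (s^-1 * (2 * (c1 * s^-1) + 2)) * s.
have c0 : 0 <= c.
  by rewrite /c !mulr_ge0 ?addr_ge0 ?mulr_ge0 ?invr_ge0 ?(ltW s0).
have cS : S (c * s / (1 + c)).
  split; first by exact: divr_ge0 (mulr_ge0 c0 (ltW s0)) (addr_ge0 ler01 c0).
  move=> {}h {}w Ghw; have [k Gkh] := G_inv Ghw.
  have [Dh Dw] := GD Ghw; have [Dk _] := GD Gkh.
  pose d := q ((- s)%:C *: w + k).
  have d0 : 0 <= d by apply/form_ge0/DL.
  (* Symmetry turns the cross term [ip w k] into [ip h h], and [q k <= s * q h]. *)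
  have d_le : d <= s * (s * q w - q h).
    rewrite /d formZD// (G_sym Ghw Gkh) -/(q h).
    by have := sS _ _ Gkh; rewrite sqrrN; nra.
  have rV : (r^-1) ^+ 2 = s^-1 by rewrite exprVn rr.
  have rC : r%:C != 0 by rewrite eq_complex /= negb_and gt_eqF.
  have kC : (- r^-1)%:C = - (r%:C)^-1 by rewrite rmorphN /= fmorphV.
  have sC : (- s)%:C = - (r%:C * r%:C) by rewrite -rmorphM -expr2 rr -rmorphN.
  (* [A - 1 / r] sends [r h + k] to [- (k - s w) / r]; likewise, for [Hc], [A + 1 / r] sends [h] to
     [(r w + h) / r]. *)
  have Ha : q (r%:C *: h + k) <= c1 * (s^-1 * d).
    have := c1P _ _ (GL r%:C Ghw Gkh).
    have -> : (- r^-1)%:C *: (r%:C *: h + k) + (r%:C *: w + h) =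
        (- r^-1)%:C *: ((- s)%:C *: w + k).
      rewrite kC sC !scalerDr !scalerA mulrNN mulNr mulVf// scaleN1r mulKf//.
      by rewrite [LHS]addrC addrA addrK.
    by rewrite formZ ?sqrrN ?rV//; exact: DL.
  have Hb : s * q (r%:C *: w + h) <= 2 * q (r%:C *: h + k) + 2 * d.
    rewrite -rr -formZ; last exact: DL.
    have -> : r%:C *: (r%:C *: w + h) =
       (- 1)%:C *: ((- s)%:C *: w + k) + (r%:C *: h + k).
      rewrite sC rmorphN rmorph1 scaleN1r scalerDr scalerA scaleNr opprD opprK.
      by rewrite -addrA [- k + _]addrC addrK.
    apply: (le_trans (form_parallelogram _ _ _)); rewrite ?sqrrN ?expr1n//; try exact: DL.
    by rewrite addrC.
  have Hc : q h <= c2 * (s^-1 * q (r%:C *: w + h)).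
    have := c2P _ _ Ghw; rewrite opprK.
    have -> : (r^-1)%:C *: h + w = (r^-1)%:C *: (r%:C *: w + h).
      by rewrite scalerDr scalerA fmorphV mulVf// scale1r addrC.
    by rewrite formZ ?rV//; exact: DL.
  have Hd : q h <= c * (s * q w - q h).
    apply: (le_trans Hc); rewrite /c -!mulrA; apply: ler_wpM2l => //.
    apply: ler_wpM2l; first by rewrite invr_ge0 ltW.
    rewrite ler_pdivlMl//; apply: (le_trans Hb).
    rewrite mulrA [leRHS](_ : _ = (2 * (c1 * s^-1) + 2) * (s * (s * q w - q h))); last by ring.
    apply: (@le_trans _ _ ((2 * (c1 * s^-1) + 2) * d)).
      by rewrite [leRHS]mulrDl lerD2r -!mulrA ler_wpM2l.
    by apply: ler_wpM2l => //; rewrite addr_ge0 ?mulr_ge0 ?invr_ge0 ?(ltW s0).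
  rewrite mulrAC ler_pdivlMr; last by rewrite ltr_pwDl.
  by rewrite mulrDr mulr1 -mulrA -lerBrDr; apply: (le_trans Hd); rewrite mulrBr [q h * c]mulrC.
have : s <= c * s / (1 + c) by apply: ge_inf => //; exists 0.
apply/negP; rewrite -ltNge ltr_pdivrMr; last by rewrite ltr_pwDl.
by rewrite mulrC ltr_pM2l// ltrDr ltr01.
Qed.

End SpectralGap.

(** * Density of C1 functions in L2 *)

Section L2Density.
Local Open Scope ring_scope.
Context {R : realType}.
Local Notation mu := (@lebesgue_measure R).
Implicit Types (f g h k : R -> R) (D : set R).

Lemma continuous_measurable_on D f : continuous f -> measurable_fun D f.
Proof.
move=> cf; apply: measurable_funTS.
exact: continuous_measurable_fun.
Qed.

Lemma sqr_dominated_convergence D f (f_ : nat -> R -> R) g (e : R) :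
  measurable D -> measurable_fun D f -> (forall n, measurable_fun D (f_ n)) ->
  mu.-integrable D (EFin \o g) ->
  (forall x, D x -> f_ ^~ x @ \oo --> f x) ->
  (forall n x, D x -> (f x - f_ n x) ^+ 2 <= g x) -> 0 < e ->
  exists n, (\int[mu]_(x in D) ((f x - f_ n x) ^+ 2)%:E < e%:E)%E.
Proof.
move=> mD mf mf_ ig f_f f_g e0.
pose F n x := ((f x - f_ n x) ^+ 2)%:E.
have mF n : measurable_fun D (F n).
  apply/measurable_EFinP; apply: (@measurable_funX _ _ _ D (fun x => f x - f_ n x)).
  exact: measurable_funB.
have F0 : {ae mu, forall x, D x -> F ^~ x @ \oo --> (cst 0%E : R -> \bar R) x}.
  apply: aeW => x Dx; apply: cvg_EFin; first by apply: nearW.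
  have h : (fun n => f x - f_ n x) @ \oo --> 0.
    by rewrite -(subrr (f x)); apply: cvgB; [exact: cvg_cst|exact: f_f].
  by have := cvgM h h; rewrite mulr0; apply; exact: eventually_filter.
have FG : {ae mu, forall x n, D x -> (`|F n x| <= (EFin \o g) x)%E}.
  by apply: aeW => x n Dx; rewrite /F /= lee_fin ger0_norm ?sqr_ge0//; exact: f_g.
have [_ _] :=
  @dominated_convergence _ _ _ mu D mD F (cst 0%E) (EFin \o g) mF (measurable_cst _) F0 ig FG.
rewrite integral0 => /fine_cvgP[[m _ fin] /cvgrPdist_lt /(_ _ e0)] [n _ small].
exists (maxn m n); have := small (maxn m n) (leq_maxr _ _).
rewrite /= sub0r normrN => /(le_lt_trans (ler_norm _)).
by rewrite -lte_fin fineK//; exact/fin/leq_maxl.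
Qed.

Lemma integral_le_twiceD D (a b c : R -> R) : measurable D ->
  measurable_fun D a -> measurable_fun D b -> measurable_fun D c ->
  (forall x, 0 <= a x) -> (forall x, 0 <= b x) -> (forall x, 0 <= c x) ->
  (forall x, D x -> a x <= 2 * b x + 2 * c x) ->
  (\int[mu]_(x in D) (a x)%:E <=
   2%:E * \int[mu]_(x in D) (b x)%:E + 2%:E * \int[mu]_(x in D) (c x)%:E)%E.
Proof.
move=> mD ma mb mc a0 b0 c0 abc.
have mE (k : R -> R) : measurable_fun D k -> measurable_fun D (fun x => (k x)%:E).
  by move=> mk; apply/measurable_EFinP.
have m2 (k : R -> R) : measurable_fun D k -> measurable_fun D (fun x => 2%:E * (k x)%:E)%E.
  by move=> mk; apply: measurable_funeM; exact: mE.
have p2 (k : R -> R) x : (forall x, 0 <= k x) -> (0 <= 2%:E * (k x)%:E)%E.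
  by move=> k0; rewrite mule_ge0// lee_fin.
rewrite -!ge0_integralZl_EFin//; try exact: mE; try by move=> x _; rewrite lee_fin.
rewrite -ge0_integralD//; try exact: m2; try by move=> x _; exact: p2.
apply: ge0_le_integral => //; try exact: mE.
  by move=> x _; rewrite lee_fin.
by apply: emeasurable_funD; exact: m2.
Qed.

Lemma measurable_sqrB D f g : measurable_fun D f -> measurable_fun D g ->
  measurable_fun D (fun x => (f x - g x) ^+ 2).
Proof.
move=> mf mg; apply: (@measurable_funX _ _ _ D (fun x => f x - g x)).
exact: measurable_funB.
Qed.

(** For squared norms, [(a + b)^2 <= 2 a^2 + 2 b^2] takes the place of Minkowski's inequality. *)
Lemma sqr_integral_triangle D f g h : measurable D ->
  measurable_fun D f -> measurable_fun D g -> measurable_fun D h ->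
  (\int[mu]_(x in D) ((f x - h x) ^+ 2)%:E <=
   2%:E * \int[mu]_(x in D) ((f x - g x) ^+ 2)%:E +
   2%:E * \int[mu]_(x in D) ((g x - h x) ^+ 2)%:E)%E.
Proof.
move=> mD mf mg mh; apply: integral_le_twiceD => //; try exact: measurable_sqrB;
  try by move=> x; exact: sqr_ge0.
by move=> x _; have := sqr_ge0 (f x - g x - (g x - h x)); lra.
Qed.

Definition clip (M y : R) := Num.max (- M) (Num.min y M).

Lemma clip_bound M y : 0 <= M -> `|clip M y| <= M.
Proof.
move=> M0; rewrite /clip ler_norml le_max lexx /= ge_max ge_min lexx orbT andbT.
by rewrite (le_trans _ M0)// oppr_le0.
Qed.

Lemma clip_id M y : `|y| <= M -> clip M y = y.
Proof.
by rewrite ler_norml /clip => /andP[? yM]; rewrite (min_idPl yM) (max_idPr _).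
Qed.

(** Truncation is the nearest-point projection onto [[-M, M]], so truncating an approximation of a
    bounded function does not spoil it. *)
Lemma clip_dist M y z : `|y| <= M -> `|y - clip M z| <= `|y - z|.
Proof.
rewrite ler_norml => /andP[My yM]; rewrite /clip.
have [zM|Mz] := leP z M; have [Mz'|zM'] := leP (- M) _ => //.
- by rewrite !ger0_norm; lra.
- by rewrite !ler0_norm; lra.
- by rewrite !ler0_norm; lra.
Qed.

Lemma clip_dist0 M y : 0 <= M -> `|y - clip M y| <= `|y|.
Proof.
move=> M0; rewrite /clip.
have [yM|My] := leP y M; have [My'|yM'] := leP (- M) _ => //.
- by rewrite subrr normr0.
- by rewrite !ler0_norm; lra.
- by rewrite !ger0_norm; lra.
- by lra.
Qed.

Lemma measurable_clip D M f : measurable D -> measurable_fun D f ->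
  measurable_fun D (fun x => clip M (f x)).
Proof.
move=> mD mf; apply: measurable_maxr; first exact: measurable_cst.
by apply: measurable_minr => //; exact: measurable_cst.
Qed.

Lemma continuous_clip M f : continuous f -> continuous (fun x => clip M (f x)).
Proof.
move=> cf x.
have c1 : {for x, continuous (fun y => Num.min (f y) M)}.
  exact: (@continuous_min _ _ _ _ x (cf x) (cvg_cst M)).
exact: (@continuous_max _ _ (cst (- M)) _ x (cvg_cst (- M)) c1).
Qed.

Definition C1 h := exists2 h', continuous h' & forall x : R, is_derive x 1 h (h' x).

Lemma C1_cont h : C1 h -> continuous h.
Proof.
by move=> [h' _ dh] x; have [d _] := dh x; apply/differentiable_continuous/derivable1_diffP.
Qed.

Lemma C1_cst c : C1 (fun=> c).
Proof. by exists (fun=> 0) => x; [exact: cvg_cst|exact: is_derive_cst]. Qed.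

Lemma C1_id : C1 id.
Proof. by exists (fun=> 1) => x; [exact: cvg_cst|exact: is_derive_id]. Qed.

Lemma C1D h k : C1 h -> C1 k -> C1 (fun x => h x + k x).
Proof.
move=> [h' ch dh] [k' ck dk]; exists (fun x => h' x + k' x) => x.
  by apply: cvgD; [exact: ch|exact: ck].
exact: is_deriveD.
Qed.

Lemma C1M h k : C1 h -> C1 k -> C1 (fun x => h x * k x).
Proof.
move=> Ch Ck; have hc := C1_cont Ch; have kc := C1_cont Ck.
move: Ch Ck => [h' ch dh] [k' ck dk]; exists (fun x => h x *: k' x + k x *: h' x) => x.
  by apply: cvgD; apply: cvgM; [exact: hc|exact: ck|exact: kc|exact: ch].
exact: is_deriveM.
Qed.

Lemma C1X h n : C1 h -> C1 (fun x => h x ^+ n).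
Proof.
move=> Ch; elim: n => [|n IH]; first exact: C1_cst.
by under eq_fun do rewrite exprS; exact: C1M.
Qed.

Lemma C1_shift h (c : R) : C1 h -> C1 (fun x => h (x + c)).
Proof.
move=> [h' ch dh]; exists (fun x => h' (x + c)) => x.
  by apply: continuous_comp; [apply: cvgD; [exact: cvg_id|exact: cvg_cst]|exact: ch].
have := @is_derive1_comp R h (shift c) x _ _ (dh (x + c)) (is_derive_shift x 1 c).
by rewrite mulr1.
Qed.

(* A polynomial vanishing at [a] and [b], and tending to 1 on [`]a, b[] as [n]
   grows. *)
Definition plateau (a b : R) n (x : R) :=
  1 - (1 - (b - a) ^- 2 * ((x - a) * (b - x))) ^+ n.

Lemma C1_plateau a b n : C1 (plateau a b n).
Proof.
apply: C1D; first exact: C1_cst.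
have C1B c h : C1 h -> C1 (fun x => c * h x) by move=> ?; apply: C1M => //; exact: C1_cst.
have C1N h : C1 h -> C1 (fun x => - h x).
  by move=> Ch; under eq_fun do rewrite -mulN1r; exact: C1B.
apply/C1N/C1X/C1D; first exact: C1_cst.
apply/C1N/C1B/C1M; first by apply: C1D; [exact: C1_id|exact: C1_cst].
by apply: C1D; [exact: C1_cst|exact/C1N/C1_id].
Qed.

Lemma plateau_bounds a b n x : a < b -> x \in `]a, b[ -> 0 <= plateau a b n x <= 1 /\
  `|1 - (b - a) ^- 2 * ((x - a) * (b - x))| < 1.
Proof.
move=> ab; rewrite in_itv /= => /andP[ax xb].
set p := (b - a) ^- 2 * _.
have p0 : 0 < p by rewrite /p mulr_gt0 ?invr_gt0 ?exprn_gt0 ?mulr_gt0 ?subr_gt0.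
have p1 : p < 1.
  by rewrite /p ltr_pdivrMl ?exprn_gt0 ?subr_gt0// mulr1; nra.
split; last by rewrite ger0_norm; lra.
have p1' : 0 <= 1 - p by rewrite subr_ge0 ltW.
rewrite /plateau -/p subr_ge0; apply/andP; split.
  by apply: exprn_ile1 => //; rewrite gerBl ltW.
by rewrite gerBl exprn_ge0.
Qed.

Lemma plateau_cvg a b x : a < b -> x \in `]a, b[ -> plateau a b n x @[n --> \oo] --> (1 : R).
Proof.
move=> ab xab; have [_ /cvg_expr h] := plateau_bounds 0 ab xab.
by rewrite -[X in _ --> X]subr0; apply: cvgB; [exact: cvg_cst|exact: h].
Qed.

(** The difference quotients of a primitive of [k] are C1, tend to [k] pointwise and are bounded by
    [M], by the mean value theorem. Multiplied by the plateau they vanish at both ends, and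
    dominated convergence gives the estimate. *)
Lemma continuous_approx_C1 k M (a b e : R) : a < b -> 0 < e -> continuous k ->
  (forall x, `|k x| <= M) ->
  exists h, [/\ C1 h, h a = 0, h b = 0 &
    (\int[mu]_(x in `]a, b[) ((k x - h x) ^+ 2)%:E < e%:E)%E].
Proof.
move=> ab e0 ck kM; have [G dG] := continuous_primitive ck.
have C1G : C1 G by exists k.
pose m n x := n.+1%:R * (G (x + n.+1%:R^-1) - G x).
have mE n x : exists2 c, c \in `]x, (x + n.+1%:R^-1)[ & m n x = k c.
  have xx : x < x + n.+1%:R^-1 by rewrite ltrDl invr_gt0 ltr0n.
  have [|c cx E] := MVT xx (fun y _ => dG y).
    by apply: continuous_subspaceT; exact: C1_cont.
  by exists c => //; rewrite /m E [x + _]addrC addrK mulrCA mulfV ?mulr1// pnatr_eq0.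
pose h n x := plateau a b n x * m n x.
have C1h n : C1 (h n).
  apply: C1M; first exact: C1_plateau.
  apply: C1M; first exact: C1_cst.
  apply: C1D; first exact: C1_shift.
  by under eq_fun do rewrite -mulN1r; apply: C1M => //; exact: C1_cst.
have [//||||||n Hn] := @sqr_dominated_convergence `]a, b[ k h (fun=> (2 * M) ^+ 2) e _ _ _ _ _ _ e0.
- exact: continuous_measurable_on.
- by move=> n; apply: continuous_measurable_on; exact: C1_cont (C1h n).
- apply: integrableS (@continuous_itv_integrable R (fun=> (2 * M) ^+ 2) a b _) => //.
    exact: subset_itv_oo_cc.
  by move=> x; exact: cvg_cst.
- move=> x; rewrite /= => xab.
  rewrite -[k x]mul1r; apply: cvgM; first exact: plateau_cvg.
  apply/cvgrPdist_lt => d d0.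
  have /cvgrPdist_lt/(_ _ d0)[r /= r0 kr] := ck x.
  have [N _ HN] := @near_infty_natSinv_lt R (PosNum r0).
  exists N => // n Nn /=; have [c + ->] := mE n x.
  rewrite in_itv /= => /andP[xc cx]; apply: kr => /=.
  have := HN n Nn => /= nr; rewrite ltr0_norm ?subr_lt0// opprB ltrBlDl.
  by apply: (lt_trans cx); rewrite ltrD2l.
- move=> n x; rewrite /= => xab; have [/andP[b0 b1] _] := plateau_bounds n ab xab.
  have [c _ mc] := mE n x.
  rewrite -real_normK ?num_real// lerXn2r ?nnegrE//.
    by rewrite mulr_ge0// (le_trans _ (kM x)).
  rewrite (le_trans (ler_normB _ _))// mulr2n mulrDl mul1r lerD// /h mc normrM.
  by rewrite -[leRHS]mul1r ler_pM// ger0_norm.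
have bz y : (y - a) * (b - y) = 0 -> plateau a b n y = 0.
  by move=> z; rewrite /plateau z mulr0 subr0 expr1n subrr.
by exists (h n); split=> //; rewrite /h bz ?mul0r// subrr ?mul0r ?mulr0.
Qed.

Lemma lte_twiceD (x y : \bar R) (a b : R) : (x < a%:E)%E -> (y < b%:E)%E ->
  (2%:E * x + 2%:E * y < (2 * a + 2 * b)%:E)%E.
Proof.
move=> xa yb; rewrite (EFinD (2 * a)) (EFinM 2 a) (EFinM 2 b).
by apply: lteD; rewrite lte_pmul2l.
Qed.

(** Three approximations follow one another: [f] is truncated, the truncation is approximated in L1
    by a continuous function truncated in turn, and the latter by a C1 function. Between functions
    bounded by [M], the squared L2 distance is at most [2 M] times the L1 distance. *)
Lemma L2_approx_C1 f (a b e : R) : a < b -> 0 < e ->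
  measurable_fun `]a, b[ f ->
  (\int[mu]_(x in `]a, b[) ((f x) ^+ 2)%:E < +oo)%E ->
  exists h, [/\ C1 h, h a = 0, h b = 0 &
    (\int[mu]_(x in `]a, b[) ((f x - h x) ^+ 2)%:E < e%:E)%E].
Proof.
(* Two triangle inequalities with factors 2 turn three errors [e / 16] into [10 e / 16]. *)
move=> ab e0 mf fi; have e80 : 0 < e / 16 by rewrite divr_gt0.
have mD : measurable (`]a, b[%classic : set R) by [].
have mf2 : measurable_fun `]a, b[ (fun x => ((f x) ^+ 2)%:E).
  by apply/measurable_EFinP; apply: (@measurable_funX _ _ _ _ f).
have [||||n Hn] := @sqr_dominated_convergence `]a, b[ f (fun n x => clip n%:R (f x))
    (fun x => f x ^+ 2) (e / 16) mD mf _ _ _ _ e80.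
- by move=> n; exact: measurable_clip.
- apply/integrableP; split; first exact: mf2.
  apply: le_lt_trans fi; apply: ge0_le_integral => //=.
  + exact: (@measurableT_comp _ _ _ _ _ _ abse _ _ _ mf2).
  + by move=> x _; rewrite lee_fin ger0_norm ?sqr_ge0.
- move=> x _; apply/cvgrPdist_lt => d d0.
  have [N fN] : exists N : nat, `|f x| < N%:R.
    by exists (Num.bound `|f x|); exact: archi_boundP.
  exists N => // n Nn /=; rewrite clip_id ?subrr ?normr0//.
  by rewrite (le_trans (ltW fN))// ler_nat.
- move=> n x _; rewrite -real_normK ?num_real// -[leRHS]real_normK ?num_real//.
  by rewrite lerXn2r ?nnegrE// clip_dist0.
pose M : R := n%:R; pose g x := clip M (f x).
have M0 : 0 <= M by exact: ler0n.
have mg : measurable_fun `]a, b[ g by exact: measurable_clip.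
have gM x : `|g x| <= M by exact: clip_bound.
have ig : mu.-integrable `]a, b[ (EFin \o g).
  apply: measurable_bounded_integrable => //.
    by rewrite /= lebesgue_measure_itv /= lte_fin ab -EFinD ltry.
  by exists M; split; rewrite ?num_real// => y My x _ /=; apply: (le_trans (gM x)); exact: ltW.
have Dfin : (mu `]a, b[ < +oo)%E by rewrite /= lebesgue_measure_itv /= lte_fin ab -EFinD ltry.
have [k_ [ck_ ik_ /fine_cvgP[[m1 _ fin]]]] := approximation_continuous_integrable mD Dfin ig.
(* Chosen so that [2 * (M + 1) * d] is [e / 16]; the added 1 keeps the denominator positive when [M]
   is 0. *)
pose d := e / (32 * (M + 1)).
have d0 : 0 < d by rewrite divr_gt0// mulr_gt0// ltr_wpDl.
move=> /cvgrPdist_lt /(_ _ d0)[m2 _ small].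
pose k x := clip M (k_ (maxn m1 m2) x).
have ck : continuous k by exact/continuous_clip.
have kM x : `|k x| <= M by exact: clip_bound.
have mk : measurable_fun `]a, b[ k by exact: continuous_measurable_on.
have gk : (\int[mu]_(x in `]a, b[) ((g x - k x) ^+ 2)%:E < (e / 16)%:E)%E.
  have := small (maxn m1 m2) (leq_maxr _ _).
  rewrite /= sub0r normrN => /(le_lt_trans (ler_norm _)).
  rewrite -lte_fin fineK; last exact/fin/leq_maxl.
  set J := integral _ _ _ => Jd.
  apply: (@le_lt_trans _ _ ((2 * M)%:E * J)%E); last first.
    apply: (@le_lt_trans _ _ ((2 * (M + 1))%:E * J)%E).
      apply: lee_wpmul2r; first by apply: integral_ge0 => x _; rewrite lee_fin.
      by rewrite lee_fin ler_wpM2l// lerDl.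
    have -> : (e / 16)%:E = ((2 * (M + 1))%:E * d%:E)%E.
      rewrite -EFinM; congr EFin; rewrite /d; field.
      by rewrite gt_eqF// ltr_wpDl.
    by rewrite lte_pmul2l// lte_fin mulr_gt0// ltr_wpDl.
  have mgk : measurable_fun `]a, b[ (fun x => (`|g x - k_ (maxn m1 m2) x|)%:E).
    apply/measurable_EFinP; apply: measurableT_comp => //; apply: measurable_funB => //.
    exact: continuous_measurable_on.
  rewrite -ge0_integralZl_EFin ?mulr_ge0//.
  apply: ge0_le_integral => //=.
  - by move=> x _; rewrite lee_fin sqr_ge0.
  - apply/measurable_EFinP; apply: (@measurable_funX _ _ _ _ (fun x => g x - k x)).
    exact: measurable_funB.
  - exact: measurable_funeM.
  - move=> x _; rewrite lee_fin -real_normK ?num_real// expr2.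
    by rewrite ler_pM ?clip_dist// (le_trans (ler_normB _ _))// mulr2n mulrDl mul1r lerD.
have [h [C1h ha hb kh]] := continuous_approx_C1 ab e80 ck kM.
exists h; split=> //.
have mh : measurable_fun `]a, b[ h.
  by apply: continuous_measurable_on; exact: C1_cont.
apply: (le_lt_trans (sqr_integral_triangle mD mf mg mh)).
have := lte_twiceD gk kh => /(le_lt_trans (sqr_integral_triangle mD mg mk mh)) gh.
have E : 2 * (e / 16) + 2 * (2 * (e / 16) + 2 * (e / 16)) <= e by lra.
by apply: lt_le_trans (lte_twiceD Hn gh) _; rewrite lee_fin.
Qed.

End L2Density.

(** * Tuples of functions on the intervals *)

Section Tuples.
Local Open Scope ring_scope.
Context {R : realType} {n : nat}.
Local Notation C := R[i].
Local Notation Re := (@complex.Re R).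
Local Notation Im := (@complex.Im R).
Local Notation U := ('I_n -> R -> C).
Variables (alpha beta : 'I_n -> R).
Hypothesis alpha_lt_beta : forall i, alpha i < beta i.
Implicit Types (u v w h k : U) (z : C) (a b : 'cV[C]_n).

Local Notation J j f := (cintegral `]alpha j, beta j[%classic f).

Definition cctup u := forall j, ccont (u j).

(** The scalar product of L2 of the union of the intervals, for functions given by one formula on
    each interval. *)
Definition tuple_ip u v : C := \sum_j J j (fun x => u j x * (v j x)^*).

Let ab j : alpha j <= beta j. Proof. exact: ltW. Qed.

Lemma cctupL z u v : cctup u -> cctup v -> cctup (z *: u + v).
Proof.
move=> cu cv j; apply: ccontD => //.
by apply: ccontM => //; exact: ccont_cst.
Qed.

Lemma ccont_ip u v j : cctup u -> cctup v -> ccont (fun x => u j x * (v j x)^*).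
Proof. by move=> cu cv; apply: ccontM => //; exact: ccontJ. Qed.

Lemma ipL z u v w : cctup u -> cctup v -> cctup w ->
  tuple_ip (z *: u + v) w = z * tuple_ip u w + tuple_ip v w.
Proof.
move=> cu cv cw; rewrite /tuple_ip mulr_sumr -big_split; apply: eq_bigr => j _ /=.
rewrite -cintZ//; last exact: ccont_ip.
rewrite -cintD//; last 2 first.
  by apply: ccontM; [exact: ccont_cst|exact: ccont_ip].
  exact: ccont_ip.
by congr cintegral; apply/funext => x; rewrite mulrDl -mulrA.
Qed.

Lemma ipJ u v : cctup u -> cctup v -> tuple_ip v u = (tuple_ip u v)^*.
Proof.
move=> cu cv; rewrite /tuple_ip rmorph_sum; apply: eq_bigr => j _ /=.
rewrite -cintJ//; last exact: ccont_ip.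
by congr cintegral; apply/funext => x; rewrite rmorphM /= conjCK mulrC.
Qed.

Lemma ip_ge0 u : cctup u -> 0 <= tuple_ip u u.
Proof. by move=> cu; apply: sumr_ge0 => j _; exact: cint_sqr_ge0. Qed.

Definition etup z a : U := fun j x => a j 0 * expo z x.

Lemma cctup_etup z a : cctup (etup z a).
Proof. by move=> j; apply: ccontM; [exact: ccont_cst|exact: ccont_expo]. Qed.

Lemma cder_etup z a j : cder (etup z a j) (fun x => tpi * z * etup z a j x).
Proof.
apply: (cder_ext (cderZ (a j 0) (cder_expo z))) => x.
by rewrite /etup mulrCA.
Qed.

(** The left side integrates the derivative of [h_j] times the conjugate of [k_j]. *)
Lemma green h h' k k' : (forall j, cder (h j) (h' j)) ->
  (forall j, cder (k j) (k' j)) -> cctup h' -> cctup k' ->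
  tuple_ip h' k + tuple_ip h k' = \sum_j (h j (beta j) * (k j (beta j))^* -
     h j (alpha j) * (k j (alpha j))^*).
Proof.
move=> dh dk ch' ck'; rewrite /tuple_ip -big_split; apply: eq_bigr => j _ /=.
have ch : cctup h by move=> i; exact: cder_cont.
have ck : cctup k by move=> i; exact: cder_cont.
rewrite -cintD//; [|exact: ccont_ip|exact: ccont_ip].
rewrite (cint_FTC _ (ab j) (cderM (dh j) (cderJ (dk j))))//.
by apply: ccontD; exact: ccont_ip.
Qed.

Definition len : R := \sum_j (beta j - alpha j).

Lemma ip_etup_real (t : R) a b :
  tuple_ip (etup t%:C a) (etup t%:C b) =
  \sum_j a j 0 * (b j 0)^* * (beta j - alpha j)%:C.
Proof.
apply: eq_bigr => j _; rewrite -cint_cst//.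
congr cintegral; apply/funext => x; rewrite /etup rmorphM /=.
by rewrite mulrACA expoJr [expo _ x * _]mulrC expoK mulr1.
Qed.

Lemma ip_exp_self (t : R) :
  tuple_ip (etup t%:C (const_mx 1)) (etup t%:C (const_mx 1)) = len%:C.
Proof.
rewrite ip_etup_real /len rmorph_sum; apply: eq_bigr => j _ /=.
by rewrite !mxE rmorph1 !mul1r.
Qed.

Lemma len_gt0 : (0 < n)%N -> 0 < len.
Proof.
move=> n_gt0; rewrite /len (bigD1 (Ordinal n_gt0))//= ltr_pwDl ?subr_gt0//.
by apply: sumr_ge0 => j _; rewrite subr_ge0.
Qed.

(** By integration by parts the boundary sum is [tpi * (z - t)] times the scalar product. Here [t]
    is real, so that conjugating [tpi * t] only changes its sign. *)
Lemma ip_etup_orth z (t : R) a b : z != t%:C ->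
  \sum_j (a j 0 * expo z (beta j) * (b j 0 * expo t%:C (beta j))^* -
          a j 0 * expo z (alpha j) * (b j 0 * expo t%:C (alpha j))^*) = 0 <->
  tuple_ip (etup z a) (etup t%:C b) = 0.
Proof.
move=> zt.
have := green (cder_etup z a) (cder_etup t%:C b).
have cf (s : C) c : cctup (fun j x => tpi * s * etup s c j x).
  by move=> j; apply: ccontM; [exact: ccont_cst|exact: cctup_etup].
move=> /(_ (cf _ _) (cf _ _)).
have e0 : forall j, ccont ((0 : U) j) by move=> j; exact: ccont_cst.
have ipl : tuple_ip (fun j x => tpi * z * etup z a j x) (etup t%:C b) =
    tpi * z * tuple_ip (etup z a) (etup t%:C b).
  have -> : (fun j x => tpi * z * etup z a j x) = (tpi * z) *: etup z a + 0.
    by rewrite addr0.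
  rewrite ipL//; try exact: cctup_etup.
  rewrite [X in _ + X]big1 ?addr0// => j _.
  rewrite (_ : (fun _ => _) = fun=> 0) ?cint_cst ?mul0r//.
  by apply/funext => x; rewrite mul0r.
have ipr : tuple_ip (etup z a) (fun j x => tpi * t%:C * etup t%:C b j x) =
    - (tpi * t%:C) * tuple_ip (etup z a) (etup t%:C b).
  rewrite /tuple_ip mulr_sumr; apply: eq_bigr => j _.
  rewrite -cintZ//; last by apply: ccont_ip; exact: cctup_etup.
  congr cintegral; apply/funext => x.
  by rewrite !rmorphM /= tpiJ conjCr mulrCA mulNr.
rewrite ipl ipr -mulrDl -mulrBr => E.
split=> [S0|ip0]; last by rewrite -E ip0 mulr0.
move: E; rewrite S0 => /eqP; rewrite !mulf_eq0 (negPf (tpi_neq0)) subr_eq0.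
by rewrite (negPf zt) => /eqP.
Qed.

(** On a bounded interval the modulus of an exponential is bounded away from 0, so a nonzero
    coefficient contributes a positive integral. *)
Lemma ip_etup_eq0 z a : tuple_ip (etup z a) (etup z a) = 0 -> a = 0.
Proof.
move=> /eqP; rewrite psumr_eq0; last by move=> j _; exact: cint_sqr_ge0.
move=> /allP H; apply/matrixP => j c; rewrite ord1 mxE; apply/eqP.
have /H/eqP : j \in index_enum 'I_n by rewrite mem_index_enum.
apply: contra_eqT => aj0.
rewrite gt_eqF//.
(* A lower bound for the squared modulus of [expo z] on the [j]-th interval, where [x] is at most
   the sum of the moduli of the endpoints in absolute value. *)
pose m := expR (- (4 * `|pi * Im z| * (`|alpha j| + `|beta j|))).
pose e := (m * (Re (a j 0) ^+ 2 + Im (a j 0) ^+ 2))%:C.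
have e0 : 0 < e.
  rewrite ltcR mulr_gt0 ?expR_gt0// lt_neqAle addr_ge0 ?sqr_ge0// andbT eq_sym.
  apply: contra aj0; rewrite paddr_eq0 ?sqr_ge0// !sqrf_eq0 => /andP[/eqP r /eqP i].
  by rewrite eq_complex r i /= !eqxx.
apply: (@lt_le_trans _ _ (e * (beta j - alpha j)%:C)).
  by rewrite mulr_gt0// ltcR subr_gt0.
rewrite -cint_cst// -subr_ge0.
have ce : ccont (fun=> e) by exact: ccont_cst.
have cq : ccont (fun x => etup z a j x * (etup z a j x)^*).
  by apply: ccont_ip; exact: cctup_etup.
have -> : cintegral `]alpha j, beta j[ (fun x => etup z a j x * (etup z a j x)^*)
    - cintegral `]alpha j, beta j[ (fun=> e) =
  cintegral `]alpha j, beta j[ (fun x => etup z a j x * (etup z a j x)^* + - e).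
  rewrite cintD//; last exact: ccont_cst.
  by congr (_ + _); rewrite !cint_cst// mulNr.
apply: cint_ge0 => x; rewrite in_itv /= => /andP[ax xb].
rewrite /etup rmorphM /= mulrACA expo_mulJ mulcJ -rmorphM -rmorphB ler0c subr_ge0.
rewrite mulrC ler_wpM2l ?addr_ge0 ?sqr_ge0// ler_expR lerN2.
apply: (le_trans (ler_norm _)); rewrite -mulrA -[4 * pi * _]mulrA !normrM.
rewrite [`|4|]gtr0_norm// -!mulrA !ler_wpM2l//.
have := ler_norm (alpha j); have := ler_norm (beta j).
have := ler_normr (- alpha j) `|alpha j|.
have := ler_norm (- alpha j); have := ler_norm (- beta j); rewrite !normrN.
by rewrite ler_norml; lra.
Qed.

End Tuples.

(** * Spectral matrices *)

Section SpectralMatrix.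
Local Open Scope ring_scope.
Context {R : realType} {n : nat}.
Local Notation C := R[i].
Local Notation Re := (@complex.Re R).
Local Notation Im := (@complex.Im R).
Implicit Types (B : 'M[C]_n) (x y v : 'cV[C]_n) (z : C).

Definition dotc x y : C := \sum_j x j 0 * (y j 0)^*.

Lemma dotcE x y : dotc x y = (map_mx Num.conj y^T *m x) 0 0.
Proof. by rewrite mxE; apply: eq_bigr => j _; rewrite !mxE mulrC. Qed.

Lemma unitary_adjoint B : B \is unitarymx -> map_mx Num.conj B^T *m B = 1%:M.
Proof. by move=> /unitarymxP/mulmx1C. Qed.

Lemma unitary_dotc B x y : B \is unitarymx -> dotc (B *m x) (B *m y) = dotc x y.
Proof.
move=> uB; rewrite !dotcE trmx_mul map_mxM mulmxA -[_ *m _ *m B]mulmxA.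
by rewrite (unitary_adjoint uB) mulmx1.
Qed.

Lemma dotc_eq0 x : dotc x x = 0 -> x = 0.
Proof.
move=> /eqP; rewrite psumr_eq0; last by move=> j _; exact: mulcJ_ge0.
move=> /allP H; apply/matrixP => j c; rewrite ord1 mxE; apply/eqP.
have := H j (mem_index_enum j).
by rewrite /= mulf_eq0 fmorph_eq0 orbb.
Qed.

Lemma expo_diagE (a : 'I_n -> R) z v j : (expo_diag a z *m v) j 0 = expo z (a j) * v j 0.
Proof. by rewrite mul_diag_mx !mxE. Qed.

Lemma expo_diagK (a : 'I_n -> R) z v : expo_diag a (- z) *m (expo_diag a z *m v) = v.
Proof.
apply/matrixP => j c; rewrite ord1 !expo_diagE mulrA expoK mul1r//.
Qed.

Lemma expo_diagKV (a : 'I_n -> R) z v : expo_diag a z *m (expo_diag a (- z) *m v) = v.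
Proof.
by apply/matrixP => j c; rewrite ord1 !expo_diagE mulrA [expo z _ * _]mulrC expoK mul1r.
Qed.

Lemma expo_diag_const (a : 'I_n -> R) z : expo_diag a z *m const_mx 1 = expo_vec z a.
Proof. by apply/matrixP => j c; rewrite ord1 expo_diagE !mxE mulr1. Qed.

Variables (alpha beta : 'I_n -> R).

Lemma char_mx_kerP B z v : char_mx alpha beta B z *m v = 0 <->
  B *m (expo_diag alpha z *m v) = expo_diag beta z *m v.
Proof.
rewrite /char_mx mulmxBl mul1mx -!mulmxA; split=> [/eqP|->]; last first.
  by rewrite expo_diagK subrr.
rewrite subr_eq0 => /eqP E; rewrite [v in RHS]E.
by rewrite expo_diagKV.
Qed.

Hypothesis n_gt0 : (0 < n)%N.

Lemma const_mx1_neq0 : (const_mx 1 : 'cV[C]_n) != 0.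
Proof.
by apply/eqP => /matrixP/(_ (Ordinal n_gt0) 0)/eqP; rewrite !mxE oner_eq0.
Qed.

Lemma det0_colP (A : 'M[C]_n) : \det A = 0 <-> exists2 v : 'cV_n, v != 0 & A *m v = 0.
Proof.
rewrite -det_tr; split=> [/eqP/det0P[v v0 vA]|[v v0 Av]].
  exists v^T; first by rewrite trmx_eq0.
  by apply: trmx_inj; rewrite trmx_mul trmxK vA trmx0.
apply/eqP/det0P; exists v^T; first by rewrite trmx_eq0.
by rewrite -trmx_mul Av trmx0.
Qed.

(** A singular characteristic matrix has a nonzero kernel, which for a spectral [B] must be the line
    of constant vectors. *)
Lemma Lambda_ofP B z : spectral_unitary alpha beta B ->
  Lambda_of alpha beta B z <-> B *m expo_vec z alpha = expo_vec z beta.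
Proof.
move=> [_ /(_ z) kerB]; rewrite -!expo_diag_const -char_mx_kerP; split.
  move=> /det0_colP[v v0 Av].
  case: kerB => kerB; have : col_ker (char_mx alpha beta B z) v by [].
    by rewrite kerB => /eqP; rewrite (negPf v0).
  by move=> _; have : [set c *: (const_mx 1 : 'cV[C]_n) | c in [set: C]] (const_mx 1);
    [exists 1 => //; rewrite scale1r|rewrite -kerB].
by move=> A1; apply/det0_colP; exists (const_mx 1) => //; exact: const_mx1_neq0.
Qed.

Hypothesis alpha_lt_beta : forall i, alpha i < beta i.

(** Unitarity makes the squared moduli of [e_z] at the [beta_j] and at the [alpha_j] have equal
    sums, while for nonreal [z] all the differences have the same strict sign. *)
Lemma unitary_expo_real B z : B \is unitarymx ->
  B *m expo_vec z alpha = expo_vec z beta -> Im z = 0.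
Proof.
move=> uB Bz; have := unitary_dotc (expo_vec z alpha) (expo_vec z alpha) uB.
rewrite Bz /dotc => /eqP; rewrite -subr_eq0 -sumrB => /eqP.
under eq_bigr do rewrite !mxE !expo_mulJ -rmorphB.
rewrite -rmorph_sum => /(congr1 Re) /= S0.
apply/eqP; rewrite -[_ == _]negbK; apply/negP => z0.
have p4 : 0 < 4 * pi :> R by rewrite mulr_gt0// pi_gt0.
move: z0; rewrite neq_lt => /orP[z0|z0]; move/eqP: S0; apply/negP.
  rewrite gt_eqF//.
  rewrite (bigD1 (Ordinal n_gt0))//= ltr_pwDl//.
    by rewrite subr_gt0 ltr_expR ltrN2 -!(mulrA (4 * pi)) (ltr_pM2l p4) ltr_nM2l.
  apply: sumr_ge0 => j _; rewrite subr_ge0 ler_expR lerN2 -!(mulrA (4 * pi)) (ler_pM2l p4).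
  by rewrite ler_nM2l// ltW.
rewrite lt_eqF//.
rewrite (bigD1 (Ordinal n_gt0))//= -oppr_gt0 opprD ltr_pwDl//.
  by rewrite oppr_gt0 subr_lt0 ltr_expR ltrN2 -!(mulrA (4 * pi)) (ltr_pM2l p4) ltr_pM2l.
rewrite -sumrN; apply: sumr_ge0 => j _.
rewrite oppr_ge0 subr_le0 ler_expR lerN2 -!(mulrA (4 * pi)) (ler_pM2l p4) ler_pM2l//.
by rewrite ltW.
Qed.

Lemma Lambda_ofE B : spectral_unitary alpha beta B ->
  Lambda_of alpha beta B =
    [set lambda%:C | lambda in
      [set lambda : R |
        B *m expo_vec lambda%:C alpha = expo_vec lambda%:C beta]].
Proof.
move=> sB; apply/seteqP; split=> [z|_ [t Bt <-]]; last by apply/Lambda_ofP.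
move=> /(Lambda_ofP _ sB) Bz.
have zE := complex_Re_Im (unitary_expo_real sB.1 Bz).
by exists (Re z); [rewrite /= -zE|rewrite -zE].
Qed.

End SpectralMatrix.

(** * From a spectrum to a matrix *)

(** Rows are chosen one at a time: fewer than [n] rows annihilate a common nonzero vector, and a row
    of the family that does not annihilate it is independent of them. *)
Lemma exists_unit_rows (F : fieldType) (n : nat) (I : Type) (P : I -> Prop)
    (g : I -> 'rV[F]_n) :
  (forall v : 'cV[F]_n, (forall t, P t -> g t *m v = 0) -> v = 0) ->
  exists l : 'I_n -> I, (forall i, P (l i)) /\
    (\matrix_i g (l i) \in unitmx)%R.
Proof.
move=> gP.
have H (k : nat) : (k <= n)%N -> exists l : 'I_k -> I, (forall i, P (l i)) /\
    row_free (\matrix_i g (l i))%R.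
  elim: k => [_|k IH kn].
    exists (fun i : 'I_0 => False_rect I (notF (ltn_ord i))); split=> [[]//|].
    by rewrite -row_leq_rank.
  have [l [Pl fl]] := IH (ltnW kn).
  set A := (\matrix_i g (l i))%R in fl.
  have : (kermx A^T != 0)%R.
    by rewrite kermx_eq0 -row_leq_rank mxrank_tr -ltnNge (leq_ltn_trans (rank_leq_row _)).
  move=> /rowV0Pn[w /sub_kermxP wA w0].
  have [t Pt gt] : exists2 t, P t & (g t *m w^T != 0)%R.
    apply/not_exists2P => H; move: w0; apply/negP; rewrite negbK.
    rewrite -(inj_eq trmx_inj) trmx0; apply/eqP/gP => t Pt; apply/eqP.
    by have [//|/negP/negPn] := H t.
  exists (fun i => if unlift ord0 i is Some j then l j else t); split.
    by move=> i; case: unliftP.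
  apply/inj_row_free => u uA.
  have uE : (\sum_i u 0 i *: g (if unlift ord0 i is Some j then l j else t) = 0)%R.
    by rewrite -[RHS]uA mulmx_sum_row; apply: eq_bigr => i _; rewrite rowK.
  rewrite big_ord_recl unlift_none in uE.
  have AE : (\sum_(i < k) u 0 (lift ord0 i) *: g (l i) =
    (\row_i u 0 (lift ord0 i)) *m A)%R.
    by rewrite mulmx_sum_row; apply: eq_bigr => i _; rewrite rowK mxE.
  move: uE; under eq_bigr do rewrite liftK.
  rewrite AE => uE.
  have Aw : (A *m w^T = 0)%R by apply: trmx_inj; rewrite trmx_mul trmxK wA trmx0.
  have u0 : (u 0 ord0 = 0)%R.
    have := congr1 (mulmx ^~ w^T) uE.
    rewrite mulmxDl -mulmxA Aw mulmx0 addr0 mul0mx -scalemxAl => /eqP.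
    by rewrite scaler_eq0 (negPf gt) orbF => /eqP.
  rewrite u0 scale0r add0r in uE.
  have /rowP ul : (\row_i u 0 (lift ord0 i) = 0)%R.
    by apply: (row_free_inj fl); rewrite uE mul0mx.
  apply/rowP => i; rewrite mxE; case: (unliftP ord0 i) => [j ->|->//].
  by have := ul j; rewrite !mxE.
have [l [Pl fl]] := H n (leqnn n).
by exists l; split=> //; rewrite -row_free_unit.
Qed.

Section SpectrumToMatrix.
Local Open Scope ring_scope.
Context {R : realType} {n : nat}.
Local Notation C := R[i].
Local Notation one := (const_mx 1 : 'cV[C]_n).
Variables (alpha beta : 'I_n -> R).
Hypothesis n_gt0 : (0 < n)%N.
Hypothesis alpha_lt_beta : forall i, alpha i < beta i.

Lemma ip_etup_dotcP z (t : R) (a : 'cV[C]_n) : z != t%:C ->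
  dotc (expo_diag beta z *m a) (expo_vec t%:C beta) =
  dotc (expo_diag alpha z *m a) (expo_vec t%:C alpha) <->
  tuple_ip alpha beta (etup z a) (etup t%:C one) = 0.
Proof.
move=> zt; rewrite -(ip_etup_orth alpha_lt_beta _ _ zt) sumrB.
have E (x : 'I_n -> R) : \sum_j a j 0 * expo z (x j) * (one j 0 * expo t%:C (x j))^* =
  dotc (expo_diag x z *m a) (expo_vec t%:C x).
  by apply: eq_bigr => j _; rewrite expo_diagE !mxE mul1r [expo z _ * _]mulrC.
rewrite !E; split=> [->|/eqP]; first by rewrite subrr.
by rewrite subr_eq0 => /eqP.
Qed.

Lemma expo_real_mulJ (t x : R) : expo t%:C x * (expo t%:C x)^* = 1.
Proof. by rewrite expoJr mulrC expoK. Qed.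

(** Orthogonality of eigenfunctions for distinct eigenvalues: [B] carries the boundary values at
    [alpha] to those at [beta] and preserves scalar products, so the boundary terms cancel. *)
Lemma ker_char_mx_orth B z (t : R) v : B \is unitarymx -> z != t%:C ->
  char_mx alpha beta B z *m v = 0 ->
  B *m expo_vec t%:C alpha = expo_vec t%:C beta ->
  tuple_ip alpha beta (etup z v) (etup t%:C one) = 0.
Proof.
move=> uB zt /char_mx_kerP Bv Bt; apply/ip_etup_dotcP => //.
by rewrite -Bv -Bt unitary_dotc.
Qed.

Definition adj (M : 'M[C]_n) : 'M[C]_n := map_mx Num.conj M^T.

Lemma adjM M N : adj (M *m N) = adj N *m adj M.
Proof. by rewrite /adj trmx_mul map_mxM. Qed.

Lemma adj_unit M : M \in unitmx -> adj M \in unitmx.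
Proof. by move=> Mu; rewrite /adj map_unitmx unitmx_tr. Qed.

(** A spectrum enters through these two properties; completeness is tested on the tuples [etup z w],
    the shape of all eigenfunctions. *)
Variable Lambda : set R.
Hypothesis orth : forall s t, Lambda s -> Lambda t -> s != t ->
  tuple_ip alpha beta (etup s%:C one) (etup t%:C one) = 0.
Hypothesis complete : forall z (w : 'cV[C]_n),
  (forall t, Lambda t -> tuple_ip alpha beta (etup z w) (etup t%:C one) = 0) -> w = 0.

(** For distinct points this is orthogonality after integration by parts; for equal points all
    entries have modulus 1. *)
Let boundary s t : Lambda s -> Lambda t ->
  dotc (expo_vec s%:C beta) (expo_vec t%:C beta) =
  dotc (expo_vec s%:C alpha) (expo_vec t%:C alpha).
Proof.
move=> Ls Lt; have [->|st] := eqVneq s t.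
  by apply: eq_bigr => j _; rewrite !mxE !expo_real_mulJ.
rewrite -(expo_diag_const beta s%:C) -(expo_diag_const alpha s%:C).
apply/ip_etup_dotcP; last exact: orth.
by apply: contra st => /eqP[->].
Qed.

Let ocol (x : 'I_n -> R) (l : 'I_n -> R) : 'M[C]_n := \matrix_(j, i) expo (l i)%:C (x j).

Lemma exists_spanning : exists l : 'I_n -> R, (forall i, Lambda (l i)) /\
  \matrix_(j, i) expo (l i)%:C (alpha j) \in unitmx.
Proof.
(* A nonreal [z] differs from every real [t], so orthogonality to each [e_t] becomes the linear
   condition [g t *m v = 0]. *)
pose z : C := 0 +i* 1.
have zt (t : R) : z != t%:C by rewrite eq_complex /= oner_eq0 andbF.
pose g (t : R) : 'rV[C]_n := \row_j ((expo t%:C (beta j))^* * expo z (beta j) -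
   (expo t%:C (alpha j))^* * expo z (alpha j)).
have [] := @exists_unit_rows _ _ R Lambda g.
  move=> v gv; apply: (complete (z := z)) => t Lt.
  apply/ip_etup_dotcP => //; apply/eqP; rewrite -subr_eq0 -sumrB; apply/eqP.
  have /matrixP/(_ 0 0) := gv t Lt; rewrite !mxE => gv0; apply: etrans gv0.
  apply: eq_bigr => j _.
  rewrite !expo_diagE !mxE; ring.
move=> l [Ll Gu]; exists l; split=> //.
rewrite -unitmx_tr -row_free_unit; apply/inj_row_free => u uA.
(* The norm of a combination depends only on the Gram matrix, which by [boundary] is the same at
   [alpha] and [beta]: a relation between the [e_t(alpha)] also holds between the [e_t(beta)],
   hence, after conjugation, between the rows [g t]. *)
have gramE (x : 'I_n -> R) v : dotc (ocol x l *m v) (ocol x l *m v) =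
    \sum_i \sum_k v i 0 * (v k 0)^* * dotc (expo_vec (l i)%:C x) (expo_vec (l k)%:C x).
  rewrite /dotc; under eq_bigr do rewrite !mxE rmorph_sum /= big_distrlr /=.
  rewrite exchange_big; apply: eq_bigr => i _ /=; rewrite exchange_big.
  apply: eq_bigr => k _ /=; rewrite mulr_sumr; apply: eq_bigr => j _ /=.
  by rewrite !mxE rmorphM /=; ring.
have uA' : ocol alpha l *m u^T = 0 by apply: trmx_inj; rewrite trmx_mul trmxK uA trmx0.
have uB' : ocol beta l *m u^T = 0.
  apply: dotc_eq0; rewrite gramE.
  under eq_bigr do under eq_bigr do rewrite boundary//.
  by rewrite -gramE uA' /dotc big1// => j _; rewrite !mxE mul0r.
have uB : u *m (ocol beta l)^T = 0 by apply: trmx_inj; rewrite trmx_mul trmxK uB' trmx0.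
have : map_mx Num.conj u *m (\matrix_i g (l i)) = 0.
  apply/rowP => j; rewrite !mxE.
  under eq_bigr do rewrite !mxE mulrBr !mulrA -!rmorphM /=.
  rewrite sumrB -!mulr_suml -!rmorph_sum /=.
  have E (x : 'I_n -> R) : \sum_i u 0 i * expo (l i)%:C (x j) = (u *m (ocol x l)^T) 0 j.
    by rewrite mxE; apply: eq_bigr => i _; rewrite !mxE.
  by rewrite !E uB uA !mxE rmorph0 !mul0r subrr.
move=> /(congr1 (mulmx ^~ (invmx (\matrix_i g (l i))))).
rewrite mulmxK// mul0mx => /rowP u0; apply/rowP => i.
by have := u0 i; rewrite !mxE => /eqP; rewrite fmorph_eq0 => /eqP.
Qed.

Lemma spectrum_unique_matrix : exists! B : 'M[C]_n,
  spectral_unitary alpha beta B /\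
  [set t%:C | t in Lambda] = Lambda_of alpha beta B.
Proof.
have [l [Ll Au]] := exists_spanning.
set A := (\matrix_(j, i) expo (l i)%:C (alpha j)) in Au.
pose D : 'M[C]_n := \matrix_(j, i) expo (l i)%:C (beta j).
(* The only matrix sending the basis of the [e_t(alpha)] to the [e_t(beta)]; equality of the Gram
   matrices makes it unitary. *)
pose B := D *m invmx A.
have BA : B *m A = D by rewrite mulmxKV.
have adj_vec (x : 'I_n -> R) (s : R) i :
    (adj (\matrix_(j, i) expo (l i)%:C (x j)) *m expo_vec s%:C x) i 0 =
    dotc (expo_vec s%:C x) (expo_vec (l i)%:C x).
  by rewrite mxE; apply: eq_bigr => j _; rewrite !mxE mulrC.
have adj_mx (x : 'I_n -> R) i k :
    (adj (\matrix_(j, i) expo (l i)%:C (x j)) *m (\matrix_(j, i) expo (l i)%:C (x j))) i k =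
    dotc (expo_vec (l k)%:C x) (expo_vec (l i)%:C x).
  by rewrite mxE; apply: eq_bigr => j _; rewrite !mxE mulrC.
have gram : adj D *m D = adj A *m A.
  by apply/matrixP => i k; rewrite !adj_mx; exact: boundary.
have BB : adj B *m B = 1%:M.
  have : adj A *m (adj B *m B *m A) = adj A *m A by rewrite -gram -BA adjM !mulmxA.
  move=> /(can_inj (mulKmx (adj_unit Au))) h.
  by rewrite -[LHS](mulmxK Au) h mulmxV.
clearbody B.
have uB : B \is unitarymx by apply/unitarymxP; exact: mulmx1C.
have Du : D \in unitmx by rewrite -BA unitmx_mul unitarymx_unit.
have DB : adj D *m B = adj A by rewrite -BA adjM -mulmxA BB mulmx1.
(* For the points of [Lambda] outside the chosen basis, both sides have the same scalar products
   with the columns of the invertible matrix [D]. *)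
have Bexpo s : Lambda s -> B *m expo_vec s%:C alpha = expo_vec s%:C beta.
  move=> Ls; apply/eqP; rewrite -subr_eq0; apply/eqP.
  apply: (can_inj (mulKmx (adj_unit Du))); rewrite mulmx0 mulmxBr mulmxA DB.
  apply/eqP; rewrite subr_eq0; apply/eqP.
  by apply/matrixP => i c; rewrite ord1 !adj_vec boundary.
have ker_one s : Lambda s -> char_mx alpha beta B s%:C *m one = 0.
  by move=> Ls; apply/char_mx_kerP; rewrite !expo_diag_const Bexpo.
have len0 := len_gt0 alpha_lt_beta n_gt0.
have ker_in s (v : 'cV[C]_n) : Lambda s -> char_mx alpha beta B s%:C *m v = 0 ->
    exists c, v = c *: one.
  move=> Ls Av.
  (* The mean of [v] weighted by the lengths: subtracting it makes the eigenfunction orthogonal to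
     [e_s] too, hence zero by completeness. *)
  pose c := (\sum_j v j 0 * (beta j - alpha j)%:C) / (len alpha beta)%:C.
  exists c; apply/eqP; rewrite -subr_eq0; apply/eqP.
  apply: (complete (z := s%:C)) => t Lt.
  have [->|st] := eqVneq t s; last first.
    apply: (@ker_char_mx_orth B) => //; last exact: Bexpo.
      by apply: contra st => /eqP[->].
    by rewrite mulmxBr Av -scalemxAr ker_one// scaler0 subrr.
  rewrite ip_etup_real//.
  under eq_bigr do rewrite !mxE rmorph1 !mulr1 mulrBl.
  rewrite sumrB -mulr_sumr -rmorph_sum /= -/(len alpha beta) /c mulfVK ?subrr//.
  by rewrite eq_complex /= negb_and gt_eqF.
have ker_out z (v : 'cV[C]_n) : (forall s, Lambda s -> z <> s%:C) ->
    char_mx alpha beta B z *m v = 0 -> v = 0.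
  move=> Lz Av; apply: (complete (z := z)) => t Lt.
  by apply: (@ker_char_mx_orth B) => //; [apply/eqP; exact: Lz|exact: Bexpo].
have sB : spectral_unitary alpha beta B.
  split=> // z; have [[s [Ls zs]]|Lz] := pselect (exists s, Lambda s /\ z = s%:C).
    right; rewrite zs; apply/seteqP; split=> [v Av|_ [c _ <-]].
      by have [c ->] := ker_in _ _ Ls Av; exists c.
    by rewrite /col_ker /= -scalemxAr ker_one// scaler0.
  left; apply/seteqP; split=> [v Av|_ ->]; last by rewrite /col_ker /= mulmx0.
  by apply: ker_out Av => s Ls zs; apply: Lz; exists s.
exists B; split; first split=> //.
  apply/seteqP; split=> [_ [s Ls <-]|z].
    by apply/(Lambda_ofP n_gt0) => //; exact: Bexpo.
  move=> /(Lambda_ofP n_gt0 _ sB) Bz; apply: contrapT => nz.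
  have : char_mx alpha beta B z *m one = 0.
    by apply/char_mx_kerP; rewrite !expo_diag_const.
  move=> /ker_out one0; have := const_mx1_neq0 (R := R) n_gt0; rewrite one0 ?eqxx//.
  by move=> s Ls zs; apply: nz; exists s.
move=> B' [sB' LB'].
suff B'A : B' *m A = D by rewrite -[B](mulmxK Au) BA -B'A mulmxK.
apply/matrixP => j i.
have : Lambda_of alpha beta B' (l i)%:C by rewrite -LB'; exists (l i).
move=> /(Lambda_ofP n_gt0 _ sB')/matrixP/(_ j 0).
rewrite !mxE => <-; apply: eq_bigr => k _; by rewrite !mxE.
Qed.

End SpectrumToMatrix.

(** * From a matrix to a spectrum *)

Section MatrixToSpectrum.
Local Open Scope ring_scope.
Context {R : realType} {n : nat}.
Local Notation C := R[i].
Local Notation Im := (@complex.Im R).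
Local Notation one := (const_mx 1 : 'cV[C]_n).
Variables (alpha beta : 'I_n -> R).
Hypothesis n_gt0 : (0 < n)%N.
Hypothesis alpha_lt_beta : forall i, alpha i < beta i.
Variable B : 'M[C]_n.
Hypothesis sB : spectral_unitary alpha beta B.
Let uB : B \is unitarymx := sB.1.

Definition real_spectrum (t : R) := B *m expo_vec t%:C alpha = expo_vec t%:C beta.

Local Notation e t := (etup t%:C one).
Local Notation ip := (tuple_ip alpha beta).

Lemma spec_orth s t : real_spectrum s -> real_spectrum t -> s != t -> ip (e s) (e t) = 0.
Proof.
move=> Ls Lt st; apply: (ker_char_mx_orth alpha_lt_beta uB) => //.
  by apply: contra st => /eqP[->].
by apply/char_mx_kerP; rewrite !expo_diag_const.
Qed.

Lemma Im_expo (t x : R) : Im (expo t%:C x) = sin (2 * pi * t * x).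
Proof.
rewrite expoE /cexp.
have -> : tpi * t%:C * x%:C = 0 +i* (2 * pi * t * x).
  by apply: complex_eqP; rewrite /tpi !(ReM, ImM) /=; ring.
by rewrite /= expR0; ring.
Qed.

(** For points at distance [u], unitarity gives equal sums of [e_u] over the [beta_j] and over the
    [alpha_j]. For small [u] the arguments of the sines in the imaginary parts stay where the sine
    increases, so the first sum has a strictly larger imaginary part. *)
Lemma spec_separated : exists2 d : R, 0 < d &
  forall s t, real_spectrum s -> real_spectrum t -> s < t -> d <= t - s.
Proof.
(* [K] bounds all endpoints, and [u < 1 / (4 K)] puts [2 pi u x] between [- pi / 2] and [pi / 2]. *)
pose K := 1 + \sum_j (`|alpha j| + `|beta j|).
have K1 j : `|alpha j| <= K /\ `|beta j| <= K.
  have H : `|alpha j| + `|beta j| <= \sum_j (`|alpha j| + `|beta j|).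
    rewrite [leRHS](bigD1 j)//= lerDl; apply: sumr_ge0 => i _.
    by rewrite addr_ge0.
  by have := normr_ge0 (alpha j); have := normr_ge0 (beta j); rewrite /K; split; lra.
have K0 : 0 < K.
  by rewrite /K ltr_pwDl// sumr_ge0// => i _; rewrite addr_ge0.
have d0 : 0 < (4 * K)^-1 by rewrite invr_gt0 mulr_gt0.
exists (4 * K)^-1 => // s t Ls Lt st; rewrite leNgt; apply/negP => tsd.
pose u := t - s; have u0 : 0 < u by rewrite subr_gt0.
have : dotc (expo_vec t%:C beta) (expo_vec s%:C beta) =
       dotc (expo_vec t%:C alpha) (expo_vec s%:C alpha).
  by rewrite -Ls -Lt unitary_dotc.
have E (x : 'I_n -> R) : dotc (expo_vec t%:C x) (expo_vec s%:C x) =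
    \sum_j expo u%:C (x j).
  apply: eq_bigr => j _; rewrite !mxE expoJr -expoD.
  by rewrite (_ : t%:C + - s%:C = u%:C)// -rmorphB.
rewrite !E => /eqP; rewrite -subr_eq0 -sumrB => /eqP /(congr1 Im).
have ImS (f : 'I_n -> C) : Im (\sum_j f j) = \sum_j Im (f j).
  by apply: (big_morph Im) => // z w; exact: ImD.
rewrite ImS; apply/eqP; rewrite gt_eqF//.
have small x : `|x| <= K -> 2 * pi * u * x \in `[- (pi / 2), pi / 2].
  move=> xK; rewrite in_itv /= -ler_norml !normrM.
  rewrite (gtr0_norm u0) (gtr0_norm (pi_gt0 R)) gtr0_norm//.
  have : u * `|x| <= 4^-1.
    apply: (@le_trans _ _ ((4 * K)^-1 * K)); first by rewrite ler_pM// ltW.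
    by rewrite invfM mulfVK// gt_eqF.
  by have := pi_gt0 R; nra.
have pos j : 0 < Im (expo u%:C (beta j) - expo u%:C (alpha j)).
  rewrite ImD (_ : Im (- _) = - Im (expo u%:C (alpha j))); last by case: expo.
  rewrite !Im_expo subr_gt0 ltr_sin ?small//; try exact: (K1 j).1; try exact: (K1 j).2.
  by rewrite ltr_pM2l// !mulr_gt0// pi_gt0.
rewrite (bigD1 (Ordinal n_gt0))//= ltr_pwDl ?pos//.
by apply: sumr_ge0 => j _; exact/ltW/pos.
Qed.

(** The interval is cut into slices of length [d], each containing at most one point. *)
Lemma spec_finite (a b : R) : exists F : seq R,
  [/\ uniq F, forall t, t \in F -> real_spectrum t &
      forall t, real_spectrum t -> a <= t < b -> t \in F].
Proof.
have [d d0 sep] := spec_separated.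
have H (m : nat) : exists F : seq R, (forall t, t \in F -> real_spectrum t) /\
    (forall t, real_spectrum t -> a <= t < a + m%:R * d -> t \in F).
  elim: m => [|m [F [FL FI]]].
    exists [::]; split=> // t _ /andP[at_]; rewrite mul0r addr0 ltNge.
    by rewrite at_.
  have [[t [Lt tI]]|no] := pselect (exists t, real_spectrum t /\
      a + m%:R * d <= t < a + m.+1%:R * d).
    exists (t :: F); split=> [s|s Ls /andP[as_ sI]].
      by rewrite inE => /predU1P[->//|]; exact: FL.
    rewrite inE; have [sm|ms] := ltP s (a + m%:R * d).
      by rewrite FI ?orbT// as_.
    move: tI sI; rewrite -natr1 mulrDl mul1r => /andP[mt tm] sI.
    have [st|ts|//] := ltgtP s t.
      by exfalso; have := sep _ _ Ls Lt st; lra.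
    by exfalso; have := sep _ _ Lt Ls ts; lra.
  exists F; split=> // s Ls /andP[as_ sI]; apply: FI => //; rewrite as_ /=.
  by rewrite ltNge; apply/negP => ms; apply: no; exists s; rewrite ms.
have [F [FL FI]] := H (Num.bound `|(b - a) / d|).
exists (undup F); split; first exact: undup_uniq.
  by move=> t; rewrite mem_undup; exact: FL.
move=> t Lt /andP[at_ tb]; rewrite mem_undup; apply: FI => //; rewrite at_ /=.
apply: (lt_le_trans tb); rewrite -lerBlDl -ler_pdivrMr// ltW//.
by apply: le_lt_trans (ler_norm _) (archi_boundP (normr_ge0 _)).
Qed.

Lemma exists_not_spec : exists t, ~ real_spectrum t.
Proof.
have [d d0 sep] := spec_separated.
have [L0|] := pselect (real_spectrum 0); last by exists 0.
exists (d / 2) => Ld; have := sep _ _ L0 Ld; rewrite divr_gt0//.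
by move=> /(_ isT); lra.
Qed.

Lemma char_mx_unit s : ~ real_spectrum s -> char_mx alpha beta B s%:C \in unitmx.
Proof.
move=> ns; rewrite unitmxE unitfE; apply/eqP => d0; apply: ns.
exact/(Lambda_ofP n_gt0 _ sB).
Qed.

(** For real [s], [len_row *m v] is the scalar product of [etup s v] with [e_s]. *)
Definition len_row : 'rV[C]_n := \row_j (beta j - alpha j)%:C.

Lemma expo_diag_dotc (a : 'I_n -> R) (t : R) x y :
  dotc (expo_diag a t%:C *m x) (expo_diag a t%:C *m y) = dotc x y.
Proof.
apply: eq_bigr => j _; rewrite !expo_diagE rmorphM /= mulrACA.
by rewrite expo_real_mulJ mul1r.
Qed.

(* At a point of the spectrum, the rank one term makes the characteristic
   matrix invertible on the orthogonal complement of the eigenfunction. *)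
Lemma char_mx_len_unit s : real_spectrum s ->
  char_mx alpha beta B s%:C + one *m len_row \in unitmx.
Proof.
move=> Ls; rewrite unitmxE unitfE; apply/eqP => /det0_colP[v v0 Mv].
have A1 : char_mx alpha beta B s%:C *m one = 0.
  by apply/char_mx_kerP; rewrite !expo_diag_const.
pose W := expo_diag beta (- s%:C) *m B *m expo_diag alpha s%:C.
have WE (x : 'cV[C]_n) : char_mx alpha beta B s%:C *m x = x - W *m x.
  by rewrite mulmxBl mul1mx.
have Wdot (x y : 'cV[C]_n) : dotc (W *m x) (W *m y) = dotc x y.
  by rewrite /W -!mulmxA -rmorphN expo_diag_dotc unitary_dotc// expo_diag_dotc.
have W1 : W *m one = one by have := WE one; rewrite A1 => /eqP; rewrite eq_sym subr_eq0 => /eqP.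
pose c := (len_row *m v) 0 0.
have cv : one *m len_row *m v = c *: one.
  apply/matrixP => i k; rewrite -mulmxA ord1 [LHS]mxE big_ord1 [RHS]mxE.
  by rewrite !(mxE _ _ i) mul1r mulr1.
have Av : char_mx alpha beta B s%:C *m v = - c *: one.
  by move: Mv; rewrite mulmxDl cv scaleNr => /eqP; rewrite addr_eq0 => /eqP.
have dotD (x y z : 'cV[C]_n) : dotc (x - y) z = dotc x z - dotc y z.
  by rewrite /dotc -sumrB; apply: eq_bigr => j _; rewrite !mxE mulrBl.
(* [W] is unitary and fixes [one], so the range of [1 - W] is orthogonal to [one]. *)
have c0 : c = 0.
  have : dotc (char_mx alpha beta B s%:C *m v) one = 0.
    by rewrite WE dotD -{2}W1 Wdot subrr.
  rewrite Av /dotc; under eq_bigr do rewrite !mxE rmorph1 !mulr1.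
  rewrite sumr_const card_ord => /eqP; rewrite mulrn_eq0 gtn_eqF//= oppr_eq0.
  by move=> /eqP.
have : col_ker (char_mx alpha beta B s%:C) v.
  by rewrite /col_ker /= Av c0 oppr0 scale0r.
have [->|->] := sB.2 s%:C.
  by move=> /eqP; rewrite (negPf v0).
move=> [k _ kv]; move: c0; rewrite /c -kv mxE.
under eq_bigr do rewrite !mxE mulr1.
rewrite -mulr_suml -rmorph_sum /= -/(len alpha beta) => /eqP.
rewrite mulf_eq0 eq_complex /= (gt_eqF (len_gt0 alpha_lt_beta n_gt0)) /= => /eqP k0.
by move: v0; rewrite -kv k0 scale0r eqxx.
Qed.

End MatrixToSpectrum.

(** * Norm estimates for integrals and for solutions of the eigenvalue equation with a source *)

Section IntegralBounds.
Local Open Scope ring_scope.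
Context {R : realType}.
Local Notation C := R[i].
Implicit Types (f g h y : R -> C).
Local Notation cint a b f := (cintegral `]a, b[%classic f).

Lemma cintB (a b : R) f g : a <= b -> ccont f -> ccont g ->
  cint a b (fun x => f x - g x) = cint a b f - cint a b g.
Proof.
move=> ab cf cg; rewrite -mulN1r -cintZ// -cintD//; last first.
  by apply: ccontM => //; exact: ccont_cst.
by congr cintegral; apply/funext => x; rewrite mulN1r.
Qed.

Lemma ccontB f g : ccont f -> ccont g -> ccont (fun x => f x - g x).
Proof.
move=> cf cg; have -> : (fun x => f x - g x) = (fun x => f x + (-1) * g x).
  by apply/funext => x; rewrite mulN1r.
by apply: ccontD => //; apply: ccontM => //; exact: ccont_cst.
Qed.

Lemma cint_le (a b : R) f g : a <= b -> ccont f -> ccont g ->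
  {in `]a, b[, forall x, f x <= g x} -> cint a b f <= cint a b g.
Proof.
move=> ab cf cg fg; rewrite -subr_ge0 -cintB//.
by apply: cint_ge0 => x /fg; rewrite subr_ge0.
Qed.

Lemma cint_split (a x b : R) f : a <= x -> x <= b -> ccont f ->
  cint a b f = cint a x f + cint x b f.
Proof.
move=> ax xb cf; have [F dF] := ccont_primitive cf.
rewrite (cint_FTC cf ax dF) (cint_FTC cf xb dF) (cint_FTC cf (le_trans ax xb) dF).
by ring.
Qed.

Lemma cint_norm_le (a b : R) f (m : C) : a <= b -> ccont f -> 0 <= m ->
  {in `]a, b[, forall x, `|f x| <= m} -> `|cint a b f| <= (b - a)%:C * m.
Proof.
move=> ab cf m0 fm; have l0 : 0 <= (b - a)%:C by rewrite ler0c subr_ge0.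
rewrite -(@ler_pXn2r _ 2) ?nnegrE ?mulr_ge0// normCK.
apply: (le_trans (cint_cauchy_schwarz ab cf)).
rewrite exprMn expr2 -mulrA ler_wpM2l// mulrC -cint_cst//.
apply: cint_le => //; [exact: ccont_sqr|exact: ccont_cst|].
move=> x xab; rewrite -normCK.
by rewrite ler_pXn2r ?nnegrE//; exact: fm.
Qed.

Lemma norm_expo_real (t x : R) : `|expo t%:C x| = 1.
Proof.
apply/eqP; rewrite -(@eqrXn2 _ 2)// ?expr1n// normCK.
by rewrite expo_real_mulJ.
Qed.

Lemma norm_expo_realN (t x : R) : `|expo (- t%:C) x| = 1.
Proof. by rewrite (_ : - t%:C = (- t)%:C) ?norm_expo_real// rmorphN. Qed.

(** The integrating factor [e_(-s)] removes the term in [h]. *)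
Lemma cder_untwist (s : R) h y :
  cder h (fun x => tpi * (y x + s%:C * h x)) ->
  cder (fun x => expo (- s%:C) x * h x) (fun x => tpi * (expo (- s%:C) x * y x)).
Proof.
move=> dh; have := cderM (cder_expo (- s%:C)) dh.
rewrite (_ : (fun x => tpi * - s%:C * _ * _ + _) =
  (fun x => tpi * (expo (- s%:C) x * y x)))//.
by apply/funext => x; ring.
Qed.

(** The increment is the integral of the derivative found in [cder_untwist], estimated by
    Cauchy-Schwarz; the factor [e_(-s)] has modulus 1. *)
Lemma untwist_bound (a b s : R) h y : a <= b -> ccont y ->
  cder h (fun x => tpi * (y x + s%:C * h x)) ->
  forall x, a <= x <= b ->
  `|expo (- s%:C) x * h x - expo (- s%:C) a * h a| <=
    `|tpi| * sqrtC (b - a)%:C * sqrtC (cint a b (fun x => y x * (y x)^*)).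
Proof.
move=> ab cy dh x /andP[ax xb].
have cg : ccont (fun x => tpi * (expo (- s%:C) x * y x)).
  by do 2!(apply: ccontM; [exact: ccont_cst || exact: ccont_expo|]).
have cq := ccont_sqr cy.
have l0 : 0 <= (b - a)%:C by rewrite ler0c subr_ge0.
have lx : 0 <= (x - a)%:C by rewrite ler0c subr_ge0.
have q0 c d : 0 <= cint c d (fun x => y x * (y x)^*) by exact: cint_sqr_ge0.
rewrite -(cint_FTC cg ax (cder_untwist dh)).
rewrite -(@ler_pXn2r _ 2) ?nnegrE ?mulr_ge0 ?normr_ge0 ?sqrtC_ge0//.
rewrite normCK; apply: (le_trans (cint_cauchy_schwarz ax cg)).
rewrite !exprMn !sqrtCK.
have -> : (fun x => tpi * (expo (- s%:C) x * y x) * (tpi * (expo (- s%:C) x * y x))^*)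
   = (fun x => `|tpi| ^+ 2 * (y x * (y x)^*)) :> (R -> C).
  apply/funext => u; rewrite -(normCK (tpi * (expo (- s%:C) u * y u))) normrM (normrM (expo _ _)).
  rewrite norm_expo_realN mul1r exprMn.
  by rewrite (normCK (y u)).
rewrite cintZ// mulrCA -mulrA ler_wpM2l ?exprn_ge0//.
rewrite ler_pM ?lx//.
  by rewrite lecR lerD2r.
by rewrite (cint_split ax xb cq) lerDl.
Qed.

End IntegralBounds.

(** * Lower bounds for the shifted operator *)

Section APriori.
Local Open Scope ring_scope.
Context {R : realType} {n : nat}.
Local Notation C := R[i].
Local Notation one := (const_mx 1 : 'cV[C]_n).
Local Notation U := ('I_n -> R -> C).
Variables (alpha beta : 'I_n -> R).
Hypothesis n_gt0 : (0 < n)%N.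
Hypothesis alpha_lt_beta : forall i, alpha i < beta i.
Variable B : 'M[C]_n.
Hypothesis sB : spectral_unitary alpha beta B.
Let uB : B \is unitarymx := sB.1.
Let ab j : alpha j <= beta j. Proof. exact: ltW. Qed.
Implicit Types (h w y k : U).

Local Notation e t := (etup t%:C one).
Local Notation ip := (tuple_ip alpha beta).
Local Notation spec := (real_spectrum alpha beta B).

Definition boundary_cond h : Prop :=
  B *m (\col_j h j (alpha j)) = \col_j h j (beta j).

(** Variation of constants writes [h_j] as [e_s (v_j + r_j)], with [r] controlled by the norm of
    [y]. The boundary condition becomes a linear system for [v]; at an eigenvalue, orthogonality to
    [e_s] supplies the extra equation that makes it invertible. *)
Lemma a_priori (s : R) : exists2 c : C, 0 <= c &
  forall h y, (forall j, cder (h j) (fun x => tpi * (y j x + s%:C * h j x))) ->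
    cctup y -> boundary_cond h -> (spec s -> ip h (e s) = 0) ->
    ip h h <= c * ip y y.
Proof.
pose L : C := (len alpha beta)%:C.
pose l j : C := (beta j - alpha j)%:C.
have l0 j : 0 <= l j by rewrite ler0c subr_ge0.
have LE : L = \sum_j l j by rewrite /L /len rmorph_sum.
have lL j : l j <= L by rewrite LE (bigD1 j)//= lerDl sumr_ge0.
have L0 : 0 <= L by rewrite LE sumr_ge0.
pose K1 : C := `|tpi| * sqrtC L.
have K10 : 0 <= K1 by rewrite mulr_ge0// sqrtC_ge0.
pose M := if `[< spec s >] then char_mx alpha beta B s%:C + one *m len_row alpha beta
          else char_mx alpha beta B s%:C.
have Mu : M \in unitmx.
  rewrite /M; case: asboolP => [Ls|nLs]; last exact: char_mx_unit.
  exact: char_mx_len_unit.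
(* [K2] bounds [M *m v]: [K1] accounts for the boundary term [rho], and [L * K1] for the integrals
   of the [r_j], which occur at an eigenvalue only. *)
pose K2 : C := K1 + L * K1.
have K20 : 0 <= K2 by rewrite addr_ge0// mulr_ge0.
pose K3 : C := \sum_i \sum_j `|invmx M i j| * K2.
have K30 : 0 <= K3 by do 2!apply: sumr_ge0 => ? _; rewrite mulr_ge0.
(* [K3] and [K1] bound [v] and [r], so this is a squared uniform bound times the total length. *)
exists (L * (K3 + K1) ^+ 2); first by rewrite mulr_ge0// exprn_ge0// addr_ge0.
move=> h y dh cy hB hs.
pose S : C := sqrtC (ip y y).
have Q0 : 0 <= ip y y by exact: ip_ge0.
have S0 : 0 <= S by rewrite sqrtC_ge0.
have SS : S ^+ 2 = ip y y by rewrite sqrtCK.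
have ch : cctup h by move=> j; exact: cder_cont (dh j).
pose g j x := expo (- s%:C) x * h j x.
pose r j x := g j x - g j (alpha j).
have cg j : ccont (g j) by apply: ccontM => //; exact: ccont_expo.
have cr j : ccont (r j) by apply: ccontB => //; exact: ccont_cst.
have rS j x : alpha j <= x <= beta j -> `|r j x| <= K1 * S.
  move=> xab; apply: (le_trans (untwist_bound (ab j) (cy j) (dh j) xab)).
  rewrite /K1 -!mulrA ler_wpM2l//; apply: ler_pM; rewrite ?sqrtC_ge0 ?cint_sqr_ge0//; first exact: l0.
    by rewrite ler_sqrtC ?nnegrE; [exact: lL|exact: l0|exact: L0].
  rewrite ler_sqrtC ?nnegrE ?cint_sqr_ge0//.
  by rewrite [leRHS](bigD1 j)//= lerDl sumr_ge0// => i _; exact: cint_sqr_ge0.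
pose v := \col_j g j (alpha j).
pose rho := \col_j r j (beta j).
have rhoS j : `|rho j 0| <= K1 * S by rewrite mxE; apply: rS; rewrite ab lexx.
have hE j x : h j x = expo s%:C x * (v j 0 + r j x).
  by rewrite /v mxE /r addrC subrK /g mulrA [expo s%:C x * _]mulrC expoK mul1r.
have Av : char_mx alpha beta B s%:C *m v = - rho.
  have Dv : expo_diag alpha s%:C *m v = \col_j h j (alpha j).
    apply/matrixP => j i; rewrite ord1 expo_diagE !mxE hE /r subrr addr0.
    by rewrite /v mxE.
  have Dr : \col_j h j (beta j) = expo_diag beta s%:C *m (v + rho).
    by apply/matrixP => j i; rewrite ord1 expo_diagE !mxE hE /v !mxE.
  rewrite mulmxBl mul1mx -!mulmxA Dv hB Dr expo_diagK.
  by rewrite opprD addrA subrr sub0r.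
have vS j : `|v j 0| <= K3 * S.
  have sigS i : `|(M *m v) i 0| <= K2 * S.
    rewrite /M; case: asboolP => [Ls|_].
      have lv : (len_row alpha beta *m v) 0 0 =
          - \sum_j cintegral `]alpha j, beta j[ (r j).
        have := hs Ls; rewrite /tuple_ip.
        under eq_bigr => j' _.
          rewrite (_ : (fun x => _ * _) = (fun x => v j' 0 + r j' x)); last first.
            apply/funext => x; rewrite /etup mxE mul1r hE mulrAC.
            by rewrite expo_real_mulJ mul1r.
          rewrite cintD//; last exact: ccont_cst.
          rewrite cint_cst//.
          over.
        rewrite big_split /= => /eqP; rewrite addr_eq0 => /eqP <-.
        by rewrite mxE; apply: eq_bigr => j' _; rewrite [len_row _ _ _ _]mxE mulrC.
      rewrite mulmxDl Av mxE [(- rho) i 0]mxE -mulmxA [(one *m _) i 0]mxE big_ord1.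
      rewrite [one i 0]mxE mul1r lv mulrDl.
      apply: (le_trans (ler_normD _ _)); rewrite !normrN lerD//.
      apply: (le_trans (ler_norm_sum _ _ _)); rewrite LE -mulrA mulr_suml.
      apply: ler_sum => j' _; apply: cint_norm_le => //; first by rewrite mulr_ge0.
      by move=> x; rewrite in_itv /= => /andP[ax xb]; apply: rS; rewrite !ltW.
    rewrite Av mxE normrN mulrDl; apply: (le_trans (rhoS i)).
    by rewrite lerDl; exact: mulr_ge0 (mulr_ge0 L0 K10) S0.
  have -> : v = invmx M *m (M *m v) by rewrite mulKmx.
  rewrite mxE; apply: (le_trans (ler_norm_sum _ _ _)).
  apply: (@le_trans _ _ (\sum_k `|invmx M j k| * K2 * S)).
    by apply: ler_sum => k _; rewrite normrM -mulrA ler_wpM2l.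
  rewrite -mulr_suml ler_wpM2r// /K3 [leRHS](bigD1 j)//= lerDl.
  by do 2!apply: sumr_ge0 => ? _; rewrite mulr_ge0.
have hS j x : x \in `]alpha j, beta j[ -> h j x * (h j x)^* <= ((K3 + K1) * S) ^+ 2.
  rewrite in_itv /= => /andP[ax xb]; rewrite -normCK.
  rewrite ler_pXn2r ?nnegrE ?mulr_ge0 ?addr_ge0// hE normrM norm_expo_real mul1r.
  rewrite mulrDl (le_trans (ler_normD _ _))// lerD//.
  by apply: rS; rewrite !ltW.
rewrite -mulrA -SS -exprMn LE mulr_suml /tuple_ip.
apply: ler_sum => j _; rewrite mulrC -cint_cst//.
apply: cint_le => //; [exact: ccont_ip|exact: ccont_cst|].
by move=> x; exact: hS.
Qed.

End APriori.

(** * Density of the span of the eigenfunctions *)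

Section Completeness.
Local Open Scope ring_scope.
Context {R : realType} {n : nat}.
Local Notation C := R[i].
Local Notation Re := (@complex.Re R).
Local Notation Im := (@complex.Im R).
Local Notation one := (const_mx 1 : 'cV[C]_n).
Local Notation U := ('I_n -> R -> C).
Variables (alpha beta : 'I_n -> R).
Hypothesis n_gt0 : (0 < n)%N.
Hypothesis alpha_lt_beta : forall i, alpha i < beta i.
Variable B : 'M[C]_n.
Hypothesis sB : spectral_unitary alpha beta B.
Let uB : B \is unitarymx := sB.1.
Implicit Types (h w y k u v : U).

Local Notation e t := (etup t%:C one).
Local Notation ip := (tuple_ip alpha beta).
Local Notation spec := (real_spectrum alpha beta B).
Local Notation bval := (boundary_cond alpha beta B).

Lemma cctup0 : cctup (0 : U).
Proof. by move=> j; exact: ccont_cst. Qed.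

Lemma ip0l u : cctup u -> ip 0 u = 0.
Proof.
move=> cu; have := ipL alpha_lt_beta (-1) cctup0 cctup0 cu.
by rewrite scaler0 addr0 mulN1r addNr.
Qed.

Lemma ipR (z : C) u v w : cctup u -> cctup v -> cctup w ->
  ip u (z *: v + w) = z^* * ip u v + ip u w.
Proof.
move=> cu cv cw; have cvw := cctupL z cv cw.
rewrite (ipJ alpha_lt_beta cvw cu) ipL// rmorphD rmorphM /=.
by rewrite -(ipJ alpha_lt_beta cv cu) -(ipJ alpha_lt_beta cw cu).
Qed.

Lemma ipZr (z : C) u v : cctup u -> cctup v -> ip u (z *: v) = z^* * ip u v.
Proof.
move=> cu cv; rewrite -[z *: v]addr0 ipR//; last exact: cctup0.
by rewrite (ipJ alpha_lt_beta cctup0 cu) ip0l// rmorph0 addr0.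
Qed.

Lemma cctup_sum (s : seq R) (c : R -> C) (f : R -> U) :
  (forall t, cctup (f t)) -> cctup (\sum_(t <- s) c t *: f t).
Proof.
move=> cf; elim: s => [|t s IH]; first by rewrite big_nil; exact: cctup0.
by rewrite big_cons; exact: cctupL.
Qed.

Lemma ip_suml (s : seq R) (c : R -> C) (f : R -> U) u :
  (forall t, cctup (f t)) -> cctup u ->
  ip (\sum_(t <- s) c t *: f t) u = \sum_(t <- s) c t * ip (f t) u.
Proof.
move=> cf cu; elim: s => [|t s IH]; first by rewrite !big_nil ip0l.
by rewrite !big_cons ipL ?IH//; exact: cctup_sum.
Qed.

Variable l0 : R.

(* [op_graph h w] states that [h] lies in the domain of the self-adjoint
   operator [1 / (2 pi i) d/dx] with boundary condition
   [B h(alpha) = h(beta)], and that this operator minus [l0] sends [h] to [w]. *)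
Definition op_graph h w : Prop :=
  [/\ forall j, cder (h j) (fun x => tpi * (w j x + l0%:C * h j x)),
      cctup w & bval h].

Lemma op_graph_cont h w : op_graph h w -> cctup h /\ cctup w.
Proof. by move=> [dh cw _]; split=> // j; exact: cder_cont (dh j). Qed.

Lemma op_graphL (z : C) h w k v : op_graph h w -> op_graph k v ->
  op_graph (z *: h + k) (z *: w + v).
Proof.
move=> [dh cw hB] [dk cv kB]; split; last 2 first.
- exact: cctupL.
- have E (x : 'I_n -> R) : \col_j (z *: h + k) j (x j) =
      z *: (\col_j h j (x j)) + \col_j k j (x j).
    by apply/matrixP => i j; rewrite !mxE.
  by rewrite /boundary_cond !E mulmxDr -scalemxAr hB kB.
move=> j; apply: (cder_ext (cderD (cderZ z (dh j)) (dk j))) => x.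
have E (a b : U) : (z *: a + b) j x = z * a j x + b j x by [].
by rewrite !E; ring.
Qed.

Lemma op_graph_etup t : spec t -> op_graph (e t) ((t - l0)%:C *: e t).
Proof.
move=> Lt; split.
- move=> j; apply: (cder_ext (cder_etup t%:C one j)) => x.
  have -> : ((t - l0)%:C *: e t) j x = (t%:C - l0%:C) * e t j x by rewrite -rmorphB.
  by ring.
- by move=> j; apply: ccontM; [exact: ccont_cst|exact: cctup_etup].
- rewrite /boundary_cond.
  have E (x : 'I_n -> R) : \col_j e t j (x j) = expo_vec t%:C x.
    by apply/matrixP => i j; rewrite [LHS]mxE [RHS]mxE /etup mxE mul1r.
  by rewrite !E.
Qed.

(** In the integration by parts the boundary terms cancel because [B] preserves scalar products, and
    the shift [l0] is real. *)
Lemma op_graph_sym h w k v : op_graph h w -> op_graph k v -> ip w k = ip h v.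
Proof.
move=> Gh Gk; have [ch cw] := op_graph_cont Gh; have [ck cv] := op_graph_cont Gk.
have [dh _ hB] := Gh; have [dk _ kB] := Gk.
have cf (f g : U) : cctup f -> cctup g -> cctup (tpi *: (l0%:C *: f + g)).
  by move=> cf cg; rewrite -[tpi *: _]addr0; apply: cctupL; [exact: cctupL|exact: cctup0].
have E (f g : U) : (fun j x => tpi * (g j x + l0%:C * f j x)) = tpi *: (l0%:C *: f + g) :> U.
  by apply/funext => j; apply/funext => x; rewrite [in RHS]/GRing.scale /= addrC.
have := green alpha_lt_beta dh dk.
rewrite !E => /(_ (cf _ _ ch cw) (cf _ _ ck cv)).
have -> : \sum_j (h j (beta j) * (k j (beta j))^* - h j (alpha j) * (k j (alpha j))^*) = 0.
  rewrite sumrB; apply/eqP; rewrite subr_eq0; apply/eqP.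
  have := unitary_dotc (\col_j h j (alpha j)) (\col_j k j (alpha j)) uB.
  rewrite hB kB /dotc => H; apply: etrans (etrans H _); apply: eq_bigr => j _;
    by rewrite !mxE.
rewrite ipZr//; last exact: cctupL.
rewrite ipR// tpiJ conjCr.
have -> : ip (tpi *: (l0%:C *: h + w)) k = tpi * (l0%:C * ip h k + ip w k).
  rewrite -[tpi *: _]addr0 ipL//; [|exact: cctupL|exact: cctup0].
  by rewrite ip0l// addr0 ipL.
move=> H; have /eqP : tpi * (ip w k - ip h v) = 0 by rewrite -[RHS]H; ring.
by rewrite mulf_eq0 (negPf tpi_neq0) subr_eq0 => /eqP.
Qed.

Lemma op_graph_etup_orth t h w : spec t -> op_graph h w ->
  ip w (e t) = (t - l0)%:C * ip h (e t).
Proof.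
move=> Lt Gh; rewrite (op_graph_sym Gh (op_graph_etup Lt)).
have [ch _] := op_graph_cont Gh.
by rewrite ipZr ?conjCr//; exact: cctup_etup.
Qed.

Hypothesis l0_spec : ~ spec l0.

(** Variation of constants solves the equation for any [v]; the boundary condition then reads
    [A *m v = - rho], which is solvable since [l0] is not an eigenvalue. *)
Lemma op_graph_surj h : cctup h -> exists k, op_graph k h.
Proof.
move=> ch.
have cf j : ccont (fun x => tpi * (expo (- l0%:C) x * h j x)).
  by do 2!(apply: ccontM; [exact: ccont_cst || exact: ccont_expo|]).
have /choice[P dP] j : exists P, cder P (fun x => tpi * (expo (- l0%:C) x * h j x)).
  exact: ccont_primitive.
pose rho := \col_j (P j (beta j) - P j (alpha j)).
pose A := char_mx alpha beta B l0%:C.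
have Au : A \in unitmx by exact: char_mx_unit.
pose v := - (invmx A *m rho).
pose k : U := fun j x => expo l0%:C x * (v j 0 - P j (alpha j) + P j x).
exists k; split=> //.
  move=> j; have dv : cder (fun x => v j 0 - P j (alpha j) + P j x)
      (fun x => 0 + tpi * (expo (- l0%:C) x * h j x)).
    by apply: cderD (dP j); exact: cder_cst.
  apply: (cder_ext (cderM (cder_expo l0%:C) dv)) => x.
  rewrite /k add0r [tpi * (_ + _)]mulrDr addrC; congr (_ + _); last by ring.
  by rewrite mulrCA [expo l0%:C x * _]mulrA [expo l0%:C x * _]mulrC expoK mul1r.
rewrite /boundary_cond.
have -> : \col_j k j (alpha j) = expo_diag alpha l0%:C *m v.
  by apply/matrixP => i j; rewrite ord1 expo_diagE [LHS]mxE /k subrK.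
have -> : \col_j k j (beta j) = expo_diag beta l0%:C *m (v + rho).
  apply/matrixP => i j; rewrite ord1 expo_diagE [LHS]mxE /k [(v + rho) i 0]mxE.
  by rewrite [rho i 0]mxE; ring.
have Av : A *m v = - rho by rewrite /v mulmxN mulKVmx.
have -> : v + rho = expo_diag beta (- l0%:C) *m (B *m (expo_diag alpha l0%:C *m v)).
  rewrite -[rho]opprK -Av /A mulmxBl mul1mx -!mulmxA opprB addrC subrK//.
by rewrite expo_diagKV.
Qed.

(** Vanishing at all endpoints puts [f] in the domain for every [B]. Subtracting the projections on
    the [e_t] nearest to [l0] leaves [d], whose norm the spectral gap bounds by that of the fixed
    [g] divided by [N]. *)
Lemma C1_span_dense (f f' : U) (eps : R) : 0 < eps ->
  (forall j, cder (f j) (f' j)) -> cctup f' ->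
  (forall j, f j (alpha j) = 0) -> (forall j, f j (beta j) = 0) ->
  exists (F : seq R) (c : R -> C), (forall t, t \in F -> spec t) /\
    let d := f - \sum_(t <- F) c t *: e t in Re (ip d d) < eps.
Proof.
move=> eps0 df cf' fa fb.
have ce t : cctup (e t) by exact: cctup_etup.
have cf : cctup f by move=> j; exact: cder_cont (df j).
pose g : U := tpi^-1 *: f' + (- l0%:C) *: f.
have cg : cctup g.
  apply: cctupL => //; rewrite -[_ *: f]addr0; apply: cctupL => //.
  exact: cctup0.
have Gf : op_graph f g.
  split=> //.
    move=> j; apply: (cder_ext (df j)) => x.
    have -> : g j x = tpi^-1 * f' j x + - l0%:C * f j x by [].
    by rewrite mulNr subrK mulVKf// tpi_neq0.
  have E (x : 'I_n -> R) : (forall j, f j (x j) = 0) -> \col_j f j (x j) = 0.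
    by move=> fx; apply/matrixP => i j; rewrite !mxE fx.
  by rewrite /boundary_cond !E// mulmx0.
have q0 u : cctup u -> 0 <= Re (ip u u).
  by move=> /(ip_ge0 alpha beta); rewrite lecE => /andP[].
(* Since [N >= 1], [N ^+ 2] is at least [N], which exceeds the squared norm of [g] divided by
   [eps]. *)
pose N := 1 + Re (ip g g) / eps.
have N1 : 1 <= N by rewrite lerDl divr_ge0 ?q0// ltW.
have N0 : 0 < N by apply: lt_le_trans N1.
have gN : Re (ip g g) < N ^+ 2 * eps.
  rewrite -ltr_pdivrMr//; apply: (@lt_le_trans _ _ N); first by rewrite ltrDr.
  by rewrite expr2 ler_peMl// ltW.
have [F [Fu FL FN]] := spec_finite n_gt0 alpha_lt_beta sB (l0 - N) (l0 + N).
(* The operator restricted to the orthogonal complement of the eigenfunctions in [F]. *)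
pose G h w := op_graph h w /\ forall t, t \in F -> ip h (e t) = 0.
have lenC0 : (len alpha beta)%:C != 0.
  by rewrite eq_complex /= negb_and gt_eqF// len_gt0.
pose c t := ip f (e t) / (len alpha beta)%:C.
exists F, c; split=> //=.
set d := f - _.
pose w := g - \sum_(t <- F) c t *: ((t - l0)%:C *: e t).
have Gdw : op_graph d w.
  rewrite /d /w -!sumrN.
  have H (s : seq R) : (forall t, t \in s -> spec t) ->
     op_graph (f + \sum_(t <- s) - (c t *: e t))
              (g + \sum_(t <- s) - (c t *: ((t - l0)%:C *: e t))).
    elim: s => [|t s IH] sL; first by rewrite !big_nil !addr0.
    rewrite !big_cons !(addrCA _ (- _)) -!scaleNr.
    apply: op_graphL; first by apply: op_graph_etup; apply: sL; exact: mem_head.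
    by apply: IH => x xs; apply: sL; rewrite inE xs orbT.
  exact: H.
have dF t : t \in F -> ip d (e t) = 0.
  move=> tF; rewrite /d addrC -scaleN1r ipL//; last exact: cctup_sum.
  rewrite ip_suml// (bigD1_seq t)//= big_seq_cond big1 ?addr0; last first.
    move=> s /andP[sF st]; rewrite (spec_orth alpha_lt_beta sB _ _ st) ?mulr0//; exact: FL.
  by rewrite ip_exp_self// /c divfK// mulN1r addNr.
have Gap : N ^+ 2 * Re (ip d d) <= Re (ip w w).
  apply: (@spectral_gap R U (@cctup R n) ip _ _ _ _ G N) => //.
  - exact: cctupL.
  - by move=> *; exact: ipL.
  - by move=> *; exact: ipJ.
  - exact: ip_ge0.
  - by move=> h v [/op_graph_cont].
  - move=> z h v h' v' [Gh hF] [Gh' hF']; split; first exact: op_graphL.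
    move=> t tF; have [ch _] := op_graph_cont Gh; have [ch' _] := op_graph_cont Gh'.
    by rewrite ipL// hF// hF'// mulr0 addr0.
  - by move=> h v h' v' [Gh _] [Gh' _]; exact: op_graph_sym.
  (* The preimage stays in the complement: its scalar product with [e_t] is multiplied by [t - l0],
     which is nonzero, to give that of [h]. *)
  - move=> h v [Gh hF]; have [ch _] := op_graph_cont Gh.
    have [k Gk] := op_graph_surj ch; exists k; split=> // t tF.
    have := op_graph_etup_orth (FL t tF) Gk; rewrite hF// => /esym/eqP.
    rewrite mulf_eq0 eq_complex /= eqxx andbT subr_eq0 => /orP[/eqP tl|/eqP//].
    by exfalso; apply: l0_spec; rewrite -tl; exact: FL.
  (* If [l0 + l] is an eigenvalue it belongs to [F], so [h] meets the orthogonality condition of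
     [a_priori]. *)
  - move=> l lN; have [K K0 KP] := a_priori n_gt0 alpha_lt_beta sB (l0 + l).
    exists (Re K); first by move: K0; rewrite lecE => /andP[].
    move=> h v [[dh cv hB] hF].
    have ch : cctup h by move=> j; exact: cder_cont (dh j).
    have cy : cctup ((- l)%:C *: h + v) by exact: cctupL.
    have := KP h ((- l)%:C *: h + v) _ cy hB _.
    have dh' j : cder (h j) (fun x => tpi * (((- l)%:C *: h + v) j x + (l0 + l)%:C * h j x)).
      apply: (cder_ext (dh j)) => x.
      have -> : ((- l)%:C *: h + v) j x = (- l)%:C * h j x + v j x by [].
      by rewrite rmorphD rmorphN /=; ring.
    have hs : spec (l0 + l) -> ip h (e (l0 + l)) = 0.
      move=> Ls; apply: hF; apply: FN => //.
      by move: lN; rewrite ltr_norml => /andP[Nl lN]; rewrite ltrD2l lN lerD2l ltW.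
    move=> /(_ dh' hs).
    have yI : Im (ip ((- l)%:C *: h + v) ((- l)%:C *: h + v)) = 0.
      by have := ip_ge0 alpha beta cy; rewrite lecE => /andP[/eqP].
    by rewrite lecE ReM yI mulr0 subr0 => /andP[].
have [cd cw] := op_graph_cont Gdw.
(* By Pythagoras: [g] is the sum of [w] and of a combination of the [e_t] orthogonal to it. *)
have wg : Re (ip w w) <= Re (ip g g).
  pose k := \sum_(t <- F) (c t * (t - l0)%:C) *: e t.
  have gE : g = 1 *: w + k.
    have -> : k = \sum_(t <- F) c t *: ((t - l0)%:C *: e t).
      by apply: eq_bigr => t _; rewrite scalerA.
    by rewrite scale1r /w subrK.
  have ck : cctup k by exact: cctup_sum.
  have wk : ip k w = 0.
    rewrite /k ip_suml// big_seq_cond big1// => t /andP[tF _].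
    rewrite (ipJ alpha_lt_beta cw (ce t)) (op_graph_etup_orth (FL t tF) Gdw).
    by rewrite dF// mulr0 rmorph0 mulr0.
  have kw : ip w k = 0 by rewrite (ipJ alpha_lt_beta ck cw) wk rmorph0.
  have cg' : cctup (1 *: w + k) by rewrite -gE.
  have -> : ip g g = ip w w + ip k k.
    by rewrite gE ipL// !ipR// wk kw rmorph1 !mul1r addr0 add0r.
  by rewrite ReD lerDl q0.
have : N ^+ 2 * Re (ip d d) < N ^+ 2 * eps.
  exact: le_lt_trans (le_trans Gap wg) gN.
by rewrite ltr_pM2l// exprn_gt0.
Qed.

End Completeness.

(** * Passage to L2 of the union of intervals *)

Section Bridge.
Local Open Scope ring_scope.
Context {R : realType} {n : nat}.
Local Notation C := R[i].
Local Notation Re := (@complex.Re R).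
Local Notation Im := (@complex.Im R).
Local Notation one := (const_mx 1 : 'cV[C]_n).
Local Notation U := ('I_n -> R -> C).
Local Notation mu := (@lebesgue_measure R).
Variables (alpha beta : 'I_n -> R).
Hypothesis n_gt0 : (0 < n)%N.
Hypothesis alpha_lt_beta : forall i, alpha i < beta i.
Hypothesis beta_lt_alpha : forall i j : 'I_n, (i < j)%N -> beta i < alpha j.
Let ab j : alpha j <= beta j. Proof. exact: ltW. Qed.

Local Notation Omega := (interval_union alpha beta).
Local Notation I j := (`]alpha j, beta j[%classic : set R).
Local Notation e t := (etup t%:C one).
Local Notation ip := (tuple_ip alpha beta).

Lemma itv_disjoint i j x : x \in `]alpha i, beta i[ -> x \in `]alpha j, beta j[ -> i = j.
Proof.
rewrite !in_itv /= => /andP[ai bi] /andP[aj bj]; apply/val_inj.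
case: (ltngtP i j) => // ij; exfalso; have := beta_lt_alpha ij; lra.
Qed.

Lemma measurable_I j : measurable (I j). Proof. by []. Qed.

Lemma Omega_bigE : Omega = \big[setU/set0]_(j <- index_enum 'I_n) I j.
Proof.
rewrite -bigcup_seq; apply/seteqP; split=> x [j _ jx]; exists j => //.
by rewrite /= mem_index_enum.
Qed.

Lemma measurable_Omega : measurable Omega.
Proof. by rewrite Omega_bigE; apply: bigsetU_measurable => j _; exact: measurable_I. Qed.

Lemma measurable_fun_Omega (f : R -> R) : (forall j, measurable_fun (I j) f) ->
  measurable_fun Omega f.
Proof.
move=> mf _ Y mY; rewrite /interval_union setI_bigcupl.
apply: fin_bigcup_measurable; first exact: finite_finset.
by move=> j _; apply: mf.
Qed.

Lemma measurable_fun_I (f : R -> R) j : measurable_fun Omega f -> measurable_fun (I j) f.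
Proof.
by apply: measurable_funS; [exact: measurable_Omega|move=> x jx; exists j].
Qed.

Lemma integral_Omega (f : R -> R) : measurable_fun Omega f ->
  (\int[mu]_(x in Omega) (f x)%:E = \sum_j \int[mu]_(x in I j) (f x)%:E)%E.
Proof.
move=> mf; rewrite Omega_bigE integral_bigsetU_EFin//.
- exact: index_enum_uniq.
- by move=> i j _ _ [x [xi xj]]; exact: itv_disjoint xi xj.
- by apply/measurable_EFinP; rewrite -Omega_bigE.
Qed.

Lemma glued_measurable (f : R -> R) (u : 'I_n -> R -> R) :
  (forall j, continuous (u j)) -> (forall j, {in I j, f =1 u j}) ->
  measurable_fun Omega f.
Proof.
move=> cu fu; apply: measurable_fun_Omega => j.
apply: (eq_measurable_fun (u j)); first by move=> x xj; rewrite (fu j).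
exact: continuous_measurable_on.
Qed.

Lemma integral_glued (f : R -> R) (u : 'I_n -> R -> R) :
  (forall j, continuous (u j)) -> (forall j, {in I j, f =1 u j}) ->
  (\int[mu]_(x in Omega) (f x)%:E = (\sum_j \int[mu]_(x in I j) (u j x))%:E)%E.
Proof.
move=> cu fu; rewrite integral_Omega; last exact: glued_measurable cu fu.
rewrite -sumEFin; apply: eq_bigr => j _.
have -> : (\int[mu]_(x in I j) (f x)%:E = \int[mu]_(x in I j) (u j x)%:E)%E.
  by apply: eq_integral => x xj; rewrite (fu j).
rewrite /Rintegral fineK//; apply: integrable_fin_num => //.
by apply: integrableS (continuous_itv_integrable (alpha j) (beta j) (cu j)) => //;
  exact: subset_itv_oo_cc.
Qed.

Lemma cintegral_glued (f : R -> C) (u : U) : cctup u -> (forall j, {in I j, f =1 u j}) ->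
  cintegral Omega f = \sum_j cintegral (I j) (u j).
Proof.
move=> cu fu; apply: complex_eqP.
  rewrite [LHS]/= /Rintegral (@integral_glued _ (fun j x => Re (u j x))).
  - by rewrite (big_morph Re ReD (erefl _)).
  - by move=> j; have [] := cu j.
  - by move=> j x xj; rewrite (fu j).
rewrite [LHS]/= /Rintegral (@integral_glued _ (fun j x => Im (u j x))).
- by rewrite (big_morph Im ImD (erefl _)).
- by move=> j; have [] := cu j.
- by move=> j x xj; rewrite (fu j).
Qed.

Lemma normc_sqr_glued (F : R -> C) (u : U) : cctup u -> (forall j, {in I j, F =1 u j}) ->
  (\int[mu]_(x in Omega) (Normc.normc (F x) ^+ 2)%:E = (Re (ip u u))%:E)%E.
Proof.
move=> cu Fu.
rewrite (@integral_glued _ (fun j x => Re (u j x * (u j x)^*))).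
- by rewrite /tuple_ip (big_morph Re ReD (erefl _)).
- by move=> j; have [] := ccont_sqr (cu j).
- by move=> j x xj; rewrite (Fu j)// normc_sqr mulcJ.
Qed.

Lemma L2_norm_glued (F : R -> C) (u : U) : cctup u -> (forall j, {in I j, F =1 u j}) ->
  L2_norm Omega F = Num.sqrt (Re (ip u u)).
Proof. by move=> cu Fu; rewrite /L2_norm /Rintegral (normc_sqr_glued cu Fu). Qed.

Lemma in_L2_glued (F : R -> C) (u : U) : cctup u -> (forall j, {in I j, F =1 u j}) ->
  in_L2 Omega F.
Proof.
move=> cu Fu; split.
- by apply: (glued_measurable (u := fun j x => Re (u j x))) => [j|j x xj];
    [have [] := cu j|rewrite (Fu j)].
- by apply: (glued_measurable (u := fun j x => Im (u j x))) => [j|j x xj];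
    [have [] := cu j|rewrite (Fu j)].
- by rewrite (normc_sqr_glued cu Fu) ltry.
Qed.

(** The intervals are disjoint, so at most one index qualifies; the value 0 is a default outside
    their union. *)
Definition glue (u : U) (x : R) : C :=
  if [pick j | x \in `]alpha j, beta j[] is Some j then u j x else 0.

Lemma glueE u j : {in I j, glue u =1 u j}.
Proof.
move=> x; rewrite inE /= => xj; rewrite /glue; case: pickP => [i xi|/(_ j)].
  by rewrite (itv_disjoint xi xj).
by rewrite xj.
Qed.

Lemma measure_Omega : fine (mu Omega) = len alpha beta.
Proof.
have := @integral_glued (fun=> 1) (fun _ _ => 1)
  (fun _ => @cst_continuous _ _ _) (fun _ _ _ => erefl _).
rewrite integral_cst; last exact: measurable_Omega.
rewrite mul1e => ->; rewrite /= /len; apply: eq_bigr => j _.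
by rewrite (@Rintegral_oo_FTC _ _ id)//; exact: cst_continuous.
Qed.

Definition nu : R := (Num.sqrt (len alpha beta))^-1.

Lemma nu_sqr : nu ^+ 2 * len alpha beta = 1.
Proof.
have l0 := len_gt0 alpha_lt_beta n_gt0.
by rewrite /nu exprVn sqr_sqrtr ?ltW// mulVf// gt_eqF.
Qed.

Lemma nu_neq0 : nu%:C != 0.
Proof.
rewrite eq_complex /= eqxx andbT; apply: contra_eq_neq nu_sqr => ->.
by rewrite expr0n mul0r eq_sym oner_eq0.
Qed.

Definition phi (t x : R) : C := nu%:C * expo t%:C x.

Lemma L2_inner_phi s t : L2_inner Omega (phi s) (phi t) = (nu ^+ 2)%:C * ip (e s) (e t).
Proof.
have cu : cctup (fun _ : 'I_n => fun x => phi s x * (phi t x)^*).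
  have cp r : ccont (phi r) by apply: ccontM; [exact: ccont_cst|exact: ccont_expo].
  by move=> j; apply: ccontM => //; exact: ccontJ.
rewrite /L2_inner (cintegral_glued cu)// /tuple_ip mulr_sumr; apply: eq_bigr => j _.
rewrite -cintZ//; last by apply: ccont_ip; exact: cctup_etup.
congr cintegral; apply/funext => x.
rewrite /etup mxE !mul1r (_ : (nu ^+ 2)%:C = nu%:C * nu%:C); last first.
  by rewrite expr2 rmorphM.
by rewrite /phi rmorphM /= conjCr mulrACA.
Qed.

(** Passing from the normalized [phi] to the [e_t] multiplies the coefficients by [nu]. *)
Lemma comb_glued (u : U) (F : R -> C) (s : seq R) (c : R -> C) :
  (forall j, {in I j, F =1 u j}) ->
  forall j, {in I j, (fun x => F x - \sum_(t <- s) c t * phi t x) =1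
    (u - \sum_(t <- s) (c t * nu%:C) *: e t) j}.
Proof.
move=> Fu j x xj; rewrite (Fu j)//.
have -> : (u - \sum_(t <- s) (c t * nu%:C) *: e t) j x =
    u j x - (\sum_(t <- s) (c t * nu%:C) *: e t) j x by [].
congr (_ - _); rewrite !fct_sumE; apply: eq_bigr => t _.
rewrite /phi mulrA /GRing.scale /= /GRing.scale /= /etup mxE mul1r.
by [].
Qed.

(** * Orthogonality and completeness extracted from a spectrum *)

Section SpectrumGivesOrthComplete.
Variable Lambda : set R.
Hypothesis sL : is_spectrum Omega Lambda.

Let sL' : L2_orthonormal_basis Omega Lambda phi.
Proof. by move: sL; rewrite /is_spectrum measure_Omega. Qed.

Lemma spectrum_orth s t : Lambda s -> Lambda t -> s != t -> ip (e s) (e t) = 0.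
Proof.
move=> Ls Lt st; have [_ /(_ _ _ Ls Lt)] := sL'.
rewrite (negPf st) L2_inner_phi => /eqP; rewrite mulf_eq0 rmorphXn expf_eq0 /=.
by rewrite (negPf nu_neq0) => /eqP.
Qed.

(** A function orthogonal to all the [e_t] is at least its own norm away from their span, so density
    with that norm as tolerance forces the norm to be 0. *)
Lemma spectrum_complete z (w : 'cV[C]_n) :
  (forall t, Lambda t -> ip (etup z w) (e t) = 0) -> w = 0.
Proof.
move=> wL; apply: (ip_etup_eq0 alpha_lt_beta (z := z)).
have cw : cctup (etup z w) by exact: cctup_etup.
have ce t : cctup (e t) by exact: cctup_etup.
have := ip_ge0 alpha beta cw; rewrite lecE => /andP[/eqP q0 q1].
apply: complex_eqP => //; apply/eqP; rewrite -[_ == _]negbK; apply/negP => qn.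
have {qn}q : 0 < Re (ip (etup z w) (etup z w)) by rewrite lt_neqAle eq_sym qn.
have [_ _ /(_ (glue (etup z w)) (in_L2_glued cw (@glueE _)))] := sL'.
have sq : 0 < Num.sqrt (Re (ip (etup z w) (etup z w))) by rewrite sqrtr_gt0.
move=> /(_ _ sq)[s [c [sLam]]].
set v := \sum_(t <- s) (c t * nu%:C) *: e t.
have cv : cctup v by exact: cctup_sum.
have cd : cctup (etup z w - v).
  by rewrite addrC -scaleN1r; exact: cctupL.
rewrite (L2_norm_glued cd (comb_glued s c (@glueE _))) ltr_sqrt//.
have vw : ip v (etup z w) = 0.
  rewrite /v ip_suml// big_seq_cond big1// => t /andP[ts _].
  by rewrite (ipJ alpha_lt_beta cw (ce t)) wL ?rmorph0 ?mulr0//; exact: sLam.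
have wv : ip (etup z w) v = 0 by rewrite (ipJ alpha_lt_beta cv cw) vw rmorph0.
have cd' : cctup ((-1) *: v + etup z w) by exact: cctupL.
rewrite addrC -scaleN1r ipL// !ipR// vw wv mulr0 addr0 add0r.
rewrite rmorphN rmorph1 mulrA mulN1r opprK mul1r ReD.
have := ip_ge0 alpha beta cv; rewrite lecE => /andP[_ /= v0].
by rewrite ltNge lerDr v0.
Qed.

End SpectrumGivesOrthComplete.

Lemma L2_approx_tuple (f : R -> C) (eps : R) : 0 < eps -> in_L2 Omega f ->
  exists h h' : U, [/\ forall j, cder (h j) (h' j), cctup h',
    forall j, h j (alpha j) = 0, forall j, h j (beta j) = 0 &
    (\int[mu]_(x in Omega) (Normc.normc (f x - glue h x) ^+ 2)%:E < eps%:E)%E].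
Proof.
move=> eps0 [mr mi ff].
have nR : 0 < n%:R :> R by rewrite ltr0n.
(* There are [2 n] errors, from the real and imaginary parts on [n] intervals, with total
   [eps / 2]. *)
pose d := eps / (4 * n%:R).
have d0 : 0 < d by rewrite divr_gt0// mulr_gt0.
have msq (g : R -> R) : measurable_fun Omega g -> measurable_fun Omega (fun x => g x ^+ 2).
  by move=> mg; apply: (@measurable_funX _ _ _ _ g).
have mnorm (F : R -> C) : measurable_fun Omega (fun x => Re (F x)) ->
    measurable_fun Omega (fun x => Im (F x)) ->
    measurable_fun Omega (fun x => Normc.normc (F x) ^+ 2).
  move=> mFr mFi; under eq_fun do rewrite normc_sqr.
  by apply: measurable_funD; exact: msq.
have fin (g : R -> R) j : measurable_fun Omega g ->
    (forall x, g x ^+ 2 <= Normc.normc (f x) ^+ 2) ->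
    (\int[mu]_(x in I j) (g x ^+ 2)%:E < +oo)%E.
  move=> mg gf; apply: le_lt_trans ff.
  apply: (@le_trans _ _ (\int[mu]_(x in Omega) (g x ^+ 2)%:E)%E).
    apply: ge0_subset_integral => //; first exact: measurable_Omega.
    - by apply/measurable_EFinP; exact: msq.
    - by move=> x _; rewrite lee_fin sqr_ge0.
    - by move=> x jx; exists j.
  apply: ge0_le_integral; first exact: measurable_Omega.
  - by move=> x _; rewrite lee_fin sqr_ge0.
  - by apply/measurable_EFinP; exact: msq.
  - by apply/measurable_EFinP; exact: mnorm.
  - by move=> x _; rewrite lee_fin.
have /choice[hr Hr] j : exists h, [/\ C1 h, h (alpha j) = 0, h (beta j) = 0 &
    (\int[mu]_(x in I j) ((Re (f x) - h x) ^+ 2)%:E < d%:E)%E].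
  apply: L2_approx_C1 => //; first exact: measurable_fun_I.
  by apply: (fin (fun x => Re (f x))) => // x; rewrite normc_sqr lerDl sqr_ge0.
have /choice[hi Hi] j : exists h, [/\ C1 h, h (alpha j) = 0, h (beta j) = 0 &
    (\int[mu]_(x in I j) ((Im (f x) - h x) ^+ 2)%:E < d%:E)%E].
  apply: L2_approx_C1 => //; first exact: measurable_fun_I.
  by apply: (fin (fun x => Im (f x))) => // x; rewrite normc_sqr lerDr sqr_ge0.
have /choice[hr' Hr'] j : exists h', continuous h' /\
    forall x : R, is_derive x 1 (hr j) (h' x).
  by have [[h' ch' dh'] _ _ _] := Hr j; exists h'.
have /choice[hi' Hi'] j : exists h', continuous h' /\
    forall x : R, is_derive x 1 (hi j) (h' x).
  by have [[h' ch' dh'] _ _ _] := Hi j; exists h'.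
pose h : U := fun j x => hr j x +i* hi j x.
have dh j : cder (h j) (fun x => hr' j x +i* hi' j x).
  by move=> x; split; [exact: (Hr' j).2|exact: (Hi' j).2].
exists h, (fun j x => hr' j x +i* hi' j x); split=> //.
- by move=> j; split; [exact: (Hr' j).1|exact: (Hi' j).1].
- by move=> j; rewrite /h; have [_ -> _ _] := Hr j; have [_ -> _ _] := Hi j.
- by move=> j; rewrite /h; have [_ _ -> _] := Hr j; have [_ _ -> _] := Hi j.
have ch : cctup h by move=> j; exact: cder_cont (dh j).
have [mgr mgi _] := in_L2_glued ch (@glueE _).
rewrite integral_Omega; last first.
  apply: mnorm.
    by under eq_fun do rewrite ReB; exact: measurable_funB.
  by under eq_fun do rewrite ImB; exact: measurable_funB.
apply: (@le_lt_trans _ _ (\sum_(j < n) (d + d)%:E)%E); last first.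
  rewrite sumEFin lte_fin sumr_const card_ord -mulr_natl.
  rewrite [ltLHS](_ : _ = eps / 2); first by rewrite ltr_pdivrMr// ltr_pMr// ltr1n.
  by rewrite /d; field; rewrite gt_eqF.
apply: lee_sum => j _; rewrite EFinD.
have [C1r _ _ dr] := Hr j; have [C1i _ _ di] := Hi j.
have mrI : measurable_fun (I j) (fun x => ((Re (f x) - hr j x) ^+ 2)%:E).
  apply/measurable_EFinP; apply: measurable_sqrB; first exact: measurable_fun_I.
  by apply: continuous_measurable_on; exact: C1_cont.
have miI : measurable_fun (I j) (fun x => ((Im (f x) - hi j x) ^+ 2)%:E).
  apply/measurable_EFinP; apply: measurable_sqrB; first exact: measurable_fun_I.
  by apply: continuous_measurable_on; exact: C1_cont.
have -> : (\int[mu]_(x in I j) (Normc.normc (f x - glue h x) ^+ 2)%:E =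
   \int[mu]_(x in I j) ((Re (f x) - hr j x) ^+ 2)%:E +
   \int[mu]_(x in I j) ((Im (f x) - hi j x) ^+ 2)%:E)%E.
  rewrite -ge0_integralD//; last 2 first.
  - by move=> x _; rewrite lee_fin sqr_ge0.
  - by move=> x _; rewrite lee_fin sqr_ge0.
  by apply: eq_integral => x xj; rewrite (glueE h xj) normc_sqr ReB ImB EFinD.
by apply: leeD; exact: ltW.
Qed.

Lemma integral_normc_triangle (f g h : R -> C) : in_L2 Omega f -> in_L2 Omega g ->
  in_L2 Omega h ->
  (\int[mu]_(x in Omega) (Normc.normc (f x - h x) ^+ 2)%:E <=
   2%:E * \int[mu]_(x in Omega) (Normc.normc (f x - g x) ^+ 2)%:E +
   2%:E * \int[mu]_(x in Omega) (Normc.normc (g x - h x) ^+ 2)%:E)%E.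
Proof.
move=> [fr fi _] [gr gi _] [hr hi _].
have E z w : Normc.normc (z - w) ^+ 2 = (Re z - Re w) ^+ 2 + (Im z - Im w) ^+ 2.
  by rewrite normc_sqr ReB ImB.
have m (k l : R -> C) : measurable_fun Omega (fun x => Re (k x)) ->
    measurable_fun Omega (fun x => Im (k x)) ->
    measurable_fun Omega (fun x => Re (l x)) ->
    measurable_fun Omega (fun x => Im (l x)) ->
    measurable_fun Omega (fun x => Normc.normc (k x - l x) ^+ 2).
  move=> kr ki lr li; under eq_fun do rewrite E.
  by apply: measurable_funD; exact: measurable_sqrB.
apply: integral_le_twiceD; try exact: m; try by move=> x; exact: sqr_ge0.
  exact: measurable_Omega.
move=> x _; rewrite !E.
have := sqr_ge0 (Re (f x) - Re (g x) - (Re (g x) - Re (h x))).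
have := sqr_ge0 (Im (f x) - Im (g x) - (Im (g x) - Im (h x))).
lra.
Qed.

Lemma spectral_matrix_spectrum (B : 'M[C]_n) : spectral_unitary alpha beta B ->
  is_spectrum Omega (real_spectrum alpha beta B).
Proof.
move=> sB; rewrite /is_spectrum measure_Omega.
change (L2_orthonormal_basis Omega (real_spectrum alpha beta B) phi).
have ce t : cctup (e t) by exact: cctup_etup.
have cp (c : R -> C) s : cctup (\sum_(t <- s) (c t * nu%:C) *: e t) by exact: cctup_sum.
split.
- move=> t _; apply: (@in_L2_glued _ (fun=> phi t)) => //.
  by move=> j; apply: ccontM; [exact: ccont_cst|exact: ccont_expo].
- move=> s t Ls Lt; rewrite L2_inner_phi; have [->|st] := eqVneq s t.
    by rewrite ip_exp_self// -rmorphM nu_sqr rmorph1.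
  by rewrite (spec_orth alpha_lt_beta sB Ls Lt st) mulr0.
move=> f fL eps eps0.
have [l0 nl0] := exists_not_spec n_gt0 alpha_lt_beta sB.
(* Two squared errors [eps ^+ 2 / 4], each doubled by the triangle inequality, add up to
   [eps ^+ 2]. *)
have e40 : 0 < eps ^+ 2 / 4 by rewrite divr_gt0// exprn_gt0.
have [h [h' [dh ch' ha hb fh]]] := L2_approx_tuple e40 fL.
have ch : cctup h by move=> j; exact: cder_cont (dh j).
have [F [c [FL /= dq]]] := C1_span_dense n_gt0 alpha_lt_beta sB nl0 e40 dh ch' ha hb.
exists F, (fun t => c t / nu%:C); split=> //.
have cE : \sum_(t <- F) c t *: e t = \sum_(t <- F) (c t / nu%:C * nu%:C) *: e t.
  by apply: eq_bigr => t _; rewrite divfK// nu_neq0.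
rewrite cE in dq.
set S := fun x => \sum_(t <- F) c t / nu%:C * phi t x.
have cd : cctup (h - \sum_(t <- F) (c t / nu%:C * nu%:C) *: e t).
  by rewrite addrC -scaleN1r; exact: cctupL.
have hS := normc_sqr_glued cd (comb_glued F (fun t => c t / nu%:C) (@glueE h)).
have SL : in_L2 Omega S.
  apply: (@in_L2_glued _ (\sum_(t <- F) (c t / nu%:C * nu%:C) *: e t)) => // j x xj.
  have := comb_glued F (fun t => c t / nu%:C) (fun j x _ => erefl ((0 : U) j x)) xj.
  have -> : (0 - \sum_(t <- F) (c t / nu%:C * nu%:C) *: e t) j x =
     - (\sum_(t <- F) (c t / nu%:C * nu%:C) *: e t) j x by rewrite sub0r.
  by rewrite sub0r => /oppr_inj.
have bound := integral_normc_triangle fL (in_L2_glued ch (@glueE h)) SL.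
have lt2 : (\int[mu]_(x in Omega) (Normc.normc (f x - S x) ^+ 2)%:E < (eps ^+ 2)%:E)%E.
  apply: (le_lt_trans bound); rewrite hS.
  have dq' : ((Re (ip (h - \sum_(t <- F) (c t / nu%:C * nu%:C) *: e t)
      (h - \sum_(t <- F) (c t / nu%:C * nu%:C) *: e t)))%:E < (eps ^+ 2 / 4)%:E)%E.
    by rewrite lte_fin.
  apply: (lt_le_trans (lte_twiceD fh dq')).
  by rewrite lee_fin; have := sqr_ge0 eps; lra.
have ge0 : (0 <= \int[mu]_(x in Omega) (Normc.normc (f x - S x) ^+ 2)%:E)%E.
  by apply: integral_ge0 => x _; rewrite lee_fin sqr_ge0.
(* Finiteness is needed to pass to the real-valued integral, which is 0 by default when the integral
   is infinite. *)
have fin : (\int[mu]_(x in Omega) (Normc.normc (f x - S x) ^+ 2)%:E)%E \is a fin_num.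
  by rewrite ge0_fin_numE//; apply: (lt_trans lt2); rewrite ltry.
have lt3 : \int[mu]_(x in Omega) (Normc.normc (f x - S x) ^+ 2) < eps ^+ 2.
  by rewrite -lte_fin /Rintegral fineK.
have ge3 : 0 <= \int[mu]_(x in Omega) (Normc.normc (f x - S x) ^+ 2).
  by apply: Rintegral_ge0 => x _; exact: sqr_ge0.
rewrite /L2_norm -(@ltr_pXn2r _ 2) ?nnegrE ?sqrtr_ge0 ?(ltW eps0)//.
by rewrite sqr_sqrtr.
Qed.

End Bridge.

Theorem corollary4p5 (R : realType) (n : nat) (n_gt0 : (0 < n)%N)
    (alpha beta : 'I_n -> R)
    (alpha_lt_beta : forall i, alpha i < beta i)
    (beta_lt_alpha : forall i j : 'I_n, (i < j)%N -> beta i < alpha j) :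
  [/\ spectral_set (interval_union alpha beta) <->
        (exists B : 'M[R[i]]_n, spectral_unitary alpha beta B),
      forall B : 'M[R[i]]_n, spectral_unitary alpha beta B ->
        Lambda_of alpha beta B =
        [set lambda%:C | lambda in
          [set lambda : R |
            B *m expo_vec lambda%:C alpha = expo_vec lambda%:C beta]] &
      forall Lambda : set R,
        is_spectrum (interval_union alpha beta) Lambda ->
        exists! B : 'M[R[i]]_n,
          spectral_unitary alpha beta B /\
          [set lambda%:C | lambda in Lambda] = Lambda_of alpha beta B].
Proof.
have spectrum_matrix Lambda : is_spectrum (interval_union alpha beta) Lambda ->
    exists! B : 'M[R[i]]_n, spectral_unitary alpha beta B /\
      [set lambda%:C | lambda in Lambda] = Lambda_of alpha beta B.
  move=> sL; apply: spectrum_unique_matrix => //.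
    by move=> s t; exact: (spectrum_orth n_gt0 alpha_lt_beta beta_lt_alpha sL).
  move=> z w wL.
  exact: (spectrum_complete alpha_lt_beta beta_lt_alpha sL wL).
split=> //; last by move=> B; exact: Lambda_ofE.
split=> [[Lambda /spectrum_matrix[B [[sB _] _]]]|[B sB]]; first by exists B.
by exists (real_spectrum alpha beta B); exact: spectral_matrix_spectrum.
Qed.
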